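(* Let $\mathbb{k}$ be a field, $T=\mathbb{k}[s,t,u]$ (standard grading), $m\ge2$, and $J=(f_1,\dots,f_m)\subset T$ an ideal generated by homogeneous polynomials with $\gcd(f_1,\dots,f_m)=1$ and $\deg(f_i)\le d$ for all $i$. Then: (i) $\operatorname{reg}(J)\le 3d-2$; (ii) $\beta_1(J)\le\beta_2(J)+m-1$; (iii) $\beta_2(J)\le H_J(\operatorname{reg}(J))\le H_J(3d-2)\le\binom{3d}{2}$; moreover, if $\deg(f_1)=\cdots=\deg(f_m)=d$, then $\beta_2(J)\le m\binom{2d}{2}$.
   Context: $\operatorname{reg}$ is Castelnuovo–Mumford regularity. $\beta_i(J)=\dim_{\mathbb{k}}\operatorname{Tor}_i^T(J,\mathbb{k})$ are the Betti numbers of $J$ (so $\beta_0$ is the number of minimal generators of $J$). $H_J(k)=\dim_{\mathbb{k}}J_k$ is the Hilbert function of $J$.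
   Formalization: The formal statement assumes d ≥ 1 (for d = 0, J = T and reg(J) = 0 > −2, so the claim fails); Betti numbers and regularity are read from an arbitrary finite minimal graded free resolution of J. *)

(* Defs.v *)
From HB Require Import structures.
From mathcomp Require Import all_boot all_order all_algebra.
From mathcomp Require Import mpoly.
Set Implicit Arguments. Unset Strict Implicit. Unset Printing Implicit Defensive.
Import GRing.Theory.
Local Open Scope ring_scope.

Notation T3 F := {mpoly F[3]}.

(* p is homogeneous of degree e for the standard grading (0 is homogeneous
   of every degree) *)
Definition is_homog (F : fieldType) (e : nat) (p : T3 F) : Prop :=
  p \is ishomog1 e (@mdeg 3).

Definition ideal_gen (F : fieldType) (m : nat) (f : 'I_m -> T3 F) (p : T3 F) : Prop :=
  exists c : 'I_m -> T3 F, p = \sum_(i < m) c i * f i.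

Definition pdvd (F : fieldType) (h p : T3 F) : Prop := exists q, p = h * q.
Definition punit (F : fieldType) (h : T3 F) : Prop := exists u, h * u = 1.

Definition gcd_one (F : fieldType) (m : nat) (f : 'I_m -> T3 F) : Prop :=
  forall h : T3 F, (forall i, pdvd h (f i)) -> punit h.

(* A minimal graded free resolution of an ideal J of T:
     0 -> F_L -> ... -> F_1 -> F_0 -> J -> 0,
   F_i = (+)_{j < b i} T(-a i j), so b i = beta_i(J) and the a i j are the
   graded shifts.  Elements of F_i are column vectors 'cV_(b i).
   g : 'rV_(b 0) lists the images of the basis of F_0 (homogeneous generators
   of J, g j of degree a 0 j); M i : 'M_(b i, b i.+1) is the differential
   F_{i+1} -> F_i.  The maps are graded of degree 0, and minimality means all
   entries of the differentials lie in the maximal homogeneous ideal (s,t,u),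
   i.e. a nonzero entry has positive degree. *)
Definition min_graded_res (F : fieldType) (J : T3 F -> Prop)
    (b : nat -> nat) (a : nat -> nat -> nat)
    (g : 'rV[T3 F]_(b 0)) (M : forall i, 'M[T3 F]_(b i, b i.+1)) (L : nat) : Prop :=
  [/\
      (forall i, (L < i)%N -> b i = 0%N),
      (forall j : 'I_(b 0), is_homog (a 0%N j) (g 0 j)),
      (forall i (p : 'I_(b i)) (q : 'I_(b i.+1)),
         M i p q = 0 \/ ((a i p < a i.+1 q)%N /\ is_homog (a i.+1 q - a i p) (M i p q))),
      (forall p, J p <-> (exists v : 'cV[T3 F]_(b 0), p = (g *m v) 0 0)) &
      ((forall v : 'cV[T3 F]_(b 0), g *m v = 0 <-> (exists w, v = M 0%N *m w)) /\
       (forall i (v : 'cV[T3 F]_(b i.+1)), M i *m v = 0 <-> (exists w, v = M i.+1 *m w)))].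

Arguments min_graded_res {F} J b a g M L.

(* Castelnuovo-Mumford regularity read off the (minimal) resolution:
   reg = max_{i <= L, j < b i} (a i j - i). *)
Definition reg_of (b : nat -> nat) (a : nat -> nat -> nat) (L : nat) : nat :=
  (\max_(i < L.+1) \max_(j < b i) (a i j - i))%N.

Definition hilb (F : fieldType) (J : T3 F -> Prop) (k h : nat) : Prop :=
  exists v : 'I_h -> T3 F,
    [/\ (forall i, J (v i) /\ is_homog k (v i)),
        (forall c : 'I_h -> F, \sum_(i < h) c i *: v i = 0 -> forall i, c i = 0) &
        (forall p, J p -> is_homog k p -> exists c : 'I_h -> F, p = \sum_(i < h) c i *: v i)].

(* Main.v *)
(** Call T = F[s,t,u] and J the ideal.  Koszul exactness turns the minimal
    generators of the second syzygies into elements of T, linearly independent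
    modulo J, killed by (s,t,u) modulo J and of degree lowered by 3; those of the
    first syzygies become triples (x,y,z) with (x,y,z) x (s,t,u) in J that are not
    of the form w(s,t,u) modulo J.  So the regularity bound says that in degrees
    k >= 3d-2 the module T/J has no socle and no such triples.

    Over an infinite extension of F there are a, b in J of degree d and a linear
    form l such that (a,b,l) is a regular sequence: the gcd condition gives nonzero
    forms of J omitting any one of the variables, hence the restriction of J to a
    suitable line has no common zero.  Every form of degree >= 2d-1 lies in (a,b,l).
    If l p = sum A_i f_i with deg p >= 3d-2, then deg A_i >= 2d-1, so
    A_i = l A'_i modulo (a,b), and l (p - sum A'_i f_i) lies in (a,b), whence p lies
    in J.  So l is a nonzerodivisor on T/J in these degrees, and surjective in
    degrees >= 2d-1, which rules out both socle elements and triples.  An F-linear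
    retraction brings this back to F.

    Multiplying each socle element by the power of s that brings it to degree R,
    for R at least the regularity, gives independent elements of J_R; this is the
    bound on the second Betti number.  The bound on the first one is a rank count
    over the fraction field. *)
Require Import Defs.
From HB Require Import structures.
From mathcomp Require Import all_boot all_order all_algebra all_fingroup.
From mathcomp Require Import mpoly generic_quotient.
From mathcomp Require Import ring zify.
From Stdlib Require Import Classical.
Set Implicit Arguments. Unset Strict Implicit. Unset Printing Implicit Defensive.
Import GRing.Theory.
Local Open Scope ring_scope.

(** * Polynomial rings over a field are gcd domains *)

Section GcdDomain.
Variable R : idomainType.
Implicit Types a b c h : R.

Definition divides a b := exists q, b = a * q.

Lemma divides_refl a : divides a a.
Proof. by exists 1; rewrite mulr1. Qed.

Lemma divides0 a : divides a 0.
Proof. by exists 0; rewrite mulr0. Qed.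

Lemma divides_trans b a c : divides a b -> divides b c -> divides a c.
Proof. by move=> [q ->] [r ->]; exists (q * r); rewrite mulrA. Qed.

Lemma divides_mulr a b c : divides a b -> divides a (b * c).
Proof. by move=> [q ->]; exists (q * c); rewrite mulrA. Qed.

Lemma divides_mull a b c : divides a b -> divides a (c * b).
Proof. by rewrite mulrC; apply: divides_mulr. Qed.

Lemma dividesD a b c : divides a b -> divides a c -> divides a (b + c).
Proof. by move=> [q ->] [r ->]; exists (q + r); rewrite mulrDr. Qed.

Lemma dividesB a b c : divides a b -> divides a c -> divides a (b - c).
Proof. by move=> [q ->] [r ->]; exists (q - r); rewrite mulrBr. Qed.

Lemma divides_mul2l c a b : divides a b -> divides (c * a) (c * b).
Proof. by move=> [q ->]; exists q; rewrite mulrA. Qed.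

Lemma divides_cancel c a b : c != 0 -> divides (c * a) (c * b) -> divides a b.
Proof. by move=> c0 [q e]; exists q; apply: (mulfI c0); rewrite mulrA. Qed.

Definition gcd_domain := forall a b, exists g,
  [/\ divides g a, divides g b & forall h, divides h a -> divides h b -> divides h g].

Hypothesis gcdR : gcd_domain.

(** For [c != 0], a gcd of [c * a] and [c * b] is divisible by [c], and cancelling [c] leaves a
    common divisor of [a] and [b]. So a gcd remains one after scaling. *)
Lemma gcd_domain_mul a b : exists g, [/\ divides g a, divides g b &
  forall c h, divides h (c * a) -> divides h (c * b) -> divides h (c * g)].
Proof.
have [g [ga gb gm]] := gcdR a b; exists g; split=> // c h ha hb.
have [-> | c0] := eqVneq c 0; first by rewrite mul0r; apply: divides0.
have [G [Ga Gb Gm]] := gcdR (c * a) (c * b).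
have [G' eG] : divides c G by apply: Gm; exists a + exists b.
apply: (divides_trans (Gm _ ha hb)); rewrite eG; apply: divides_mul2l.
by apply: gm; apply: (divides_cancel c0); rewrite -eG.
Qed.

Lemma gcd_domain_seq (s : seq R) : exists g, (forall x, x \in s -> divides g x) /\
  forall c h, (forall x, x \in s -> divides h (c * x)) -> divides h (c * g).
Proof.
elim: s => [|x s [g [gs gm]]].
  by exists 0; split=> // c h _; rewrite mulr0; apply: divides0.
have [k [kx kg km]] := gcd_domain_mul x g; exists k; split.
  move=> y; rewrite inE => /orP [/eqP -> // | /gs gy]; exact: divides_trans gy.
move=> c h H; apply: km; first by apply: H; rewrite mem_head.
by apply: gm => y ys; apply: H; rewrite inE ys orbT.
Qed.

Lemma gcd_domain_coprime (I : finType) (f : I -> R) :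
    (forall h, (forall i, divides h (f i)) -> divides h 1) ->
  forall c h, (forall i, divides h (c * f i)) -> divides h c.
Proof.
move=> cop c h H; have [g [gs gm]] := gcd_domain_seq (codom f).
have g1 : divides g 1 by apply: cop => i; apply/gs/codom_f.
apply: (divides_trans (b := c * g)); first by apply: gm => x /codomP [i ->].
by rewrite -[X in divides _ X]mulr1; apply: divides_mul2l.
Qed.

(* Quantifying over [c] makes primitivity stable under products without
   mentioning a gcd of the coefficients. *)
Definition primitive (p : {poly R}) :=
  forall c h, (forall i, divides h (c * p`_i)) -> divides h c.

Lemma primitive_part (p : {poly R}) : p != 0 ->
  exists g p0, [/\ g != 0, p = g *: p0 & primitive p0].
Proof.
move=> p0; have [g [gs gm]] := gcd_domain_seq p.
have gi i : divides g p`_i.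
  case: (ltnP i (size p)) => hi; first by apply/gs/mem_nth.
  by rewrite nth_default //; apply: divides0.
(* Divisibility is only a proposition, so the quotients are chosen one coefficient at a time. *)
have [q qE] : exists q : nat -> R, forall i, (i < size p)%N -> p`_i = g * q i.
  have H s : exists q : nat -> R, forall i, (i < s)%N -> p`_i = g * q i.
    elim: s => [|s [q qE]]; first by exists (fun=> 0).
    have [r rE] := gi s; exists (fun i => if i == s then r else q i) => i.
    by rewrite ltnS leq_eqVlt; case: eqP => [-> //| _ /qE].
  exact: H.
have pE : p = g *: \poly_(i < size p) q i.
  apply/polyP => i; rewrite coefZ coef_poly; case: ltnP => hi; first exact: qE.
  by rewrite nth_default // mulr0.
have g0 : g != 0 by apply: contraNneq p0 => g0; rewrite pE g0 scale0r.
exists g, (\poly_(i < size p) q i); split=> // c h H.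
apply: (divides_cancel g0); rewrite [g * c]mulrC; apply: gm => x /(nthP 0) [i hi <-].
by rewrite pE coefZ mulrCA; apply: divides_mul2l.
Qed.

Lemma primitive_neq0 (p : {poly R}) : primitive p -> p != 0.
Proof.
move=> pp; apply/eqP => p0; have [] : divides 0 1.
  by apply: pp => i; rewrite p0 coef0 mulr0; apply: divides0.
by move=> q /eqP; rewrite mul0r oner_eq0.
Qed.

(** Gauss's lemma by gcds alone, without irreducible factors. If [d] divides both [h] and [c] times
    the leading coefficient of one factor, that leading term can be removed. Induction on the
    primitive part of what remains then gives that [d] divides [c]. *)
Lemma primitiveM (p q : {poly R}) : primitive p -> primitive q -> primitive (p * q).
Proof.
have [n] := ubnP (size p + size q)%N; elim: n p q => // n IH p q.
rewrite ltnS => sz pp pq.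
have wlog_part (p1 q1 : {poly R}) c h : (size p1 + size q1 <= n)%N ->
    primitive p1 -> primitive q1 ->
    (forall i, divides h (c * (p1 * q1)`_i)) -> forall d, divides d h ->
    divides d (c * lead_coef p1) -> divides d c.
  move=> sz1 pp1 pq1 H d dh dl; apply: (pp1) => i.
  have dH j : divides d (c * (p1 * q1)`_j) by apply: divides_trans (H j).
  have p10 := primitive_neq0 pp1.
  pose r := p1 - lead_coef p1 *: 'X^((size p1).-1).
  have dr j : divides d (c * (r * q1)`_j).
    rewrite /r mulrBl coefB mulrBr; apply: dividesB => //.
    by rewrite -scalerAl coefZ mulrA; apply: divides_mulr.
  have sr : (size r < size p1)%N.
    rewrite -[X in (_ < X)%N]prednK ?size_poly_gt0 // ltnS.
    apply/leq_sizeP => j hj; rewrite coefB coefZ coefXn.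
    case: eqP hj => [-> | ne hj]; first by rewrite mulr1 subrr.
    rewrite mulr0 subr0 nth_default // -[size p1]prednK ?size_poly_gt0 //.
    by rewrite ltn_neqAle eq_sym hj andbT; apply/eqP.
  have dri : divides d (c * r`_i).
    have [-> | r0] := eqVneq r 0; first by rewrite coef0 mulr0; apply: divides0.
    have [g [r' [g0 rE pr']]] := primitive_part r0.
    rewrite rE coefZ mulrA; apply: divides_mulr.
    have sr' : size r' = size r by rewrite rE size_scale.
    have szr : (size r' + size q1 < n)%N.
      by rewrite sr'; apply: leq_trans sz1; rewrite ltn_add2r.
    apply: (IH _ _ szr pr' pq1) => j.
    by rewrite -mulrA -coefZ scalerAl -rE.
  have -> : p1`_i = r`_i + lead_coef p1 * ('X^((size p1).-1))`_i.
    by rewrite /r coefB coefZ subrK.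
  by rewrite mulrDr mulrA; apply: dividesD => //; apply: divides_mulr.
move=> c h H.
(* With [d] and [e] the gcds of [h] with [c * lead_coef p] and [c * lead_coef q], both divide [c].
   Since [h] divides [c * lead_coef p * lead_coef q], it divides [lead_coef q * d], hence
   [c * lead_coef q], hence [e]. *)
have [d [dh dl dm]] := gcd_domain_mul h (c * lead_coef p).
have dc : divides d c by apply: (wlog_part p q c h).
have [e [eh el em]] := gcd_domain_mul h (c * lead_coef q).
have ec : divides e c.
  by apply: (wlog_part q p c h) => // [|i]; [rewrite addnC | rewrite [q * p]mulrC].
apply: divides_trans ec; rewrite -[e]mul1r; apply: em; rewrite mul1r.
  exact: divides_refl.
rewrite mulrC; apply: (divides_trans (b := lead_coef q * d)); last exact: divides_mul2l.
apply: dm; first exact/divides_mull/divides_refl.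
have -> : lead_coef q * (c * lead_coef p) = c * (p * q)`_(size (p * q)).-1.
  by rewrite -/(lead_coef _) lead_coefM mulrCA [_ * lead_coef p]mulrC.
exact: H.
Qed.

(** Over a domain [%|] is pseudo-divisibility and only gives [c *: a = q * D]. Writing [q = g *: r]
    with [r] primitive, [r * D] is primitive by Gauss, so [c] divides [g] and can be cancelled. *)
Lemma primitive_dvdp (D a : {poly R}) : primitive D -> D %| a -> exists q, a = D * q.
Proof.
move=> pD /Pdiv.Idomain.dvdpP [[c q] /= c0 e].
have [q0 | q0] := eqVneq q 0.
  exists 0; rewrite mulr0; apply/eqP.
  by have/eqP := e; rewrite q0 mul0r scale_poly_eq0 (negbTE c0).
have [g [r [g0 qE pr]]] := primitive_part q0.
have [k gE] : divides c g.
  apply: (primitiveM pr pD) => i; exists a`_i.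
  by rewrite -coefZ scalerAl -qE -e coefZ.
exists (k *: r); have cP : c%:P != 0 by rewrite polyC_eq0.
by apply: (mulfI cP); rewrite !mul_polyC e qE gE scalerAr scalerA mulrC.
Qed.

End GcdDomain.

(** The gcd is the gcd of the contents times the primitive part of the pseudo-gcd of the primitive
    parts. *)
Lemma gcd_domain_poly (R : idomainType) : gcd_domain R -> gcd_domain {poly R}.
Proof.
move=> gcdR a b.
have [-> | a0] := eqVneq a 0.
  by exists b; split=> //; [apply: divides0 | apply: divides_refl].
have [-> | b0] := eqVneq b 0.
  by exists a; split=> //; [apply: divides_refl | apply: divides0].
have [ca [a' [ca0 aE pa]]] := primitive_part gcdR a0.
have [cb [b' [cb0 bE pb]]] := primitive_part gcdR b0.
have g0 : gcdp a' b' != 0 by rewrite gcdp_eq0 negb_and primitive_neq0.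
have [k [D [k0 DE pD]]] := primitive_part gcdR g0.
have [qa qaE] : exists q, a' = D * q.
  by apply: primitive_dvdp => //; rewrite -(dvdpZl _ _ k0) -DE dvdp_gcdl.
have [qb qbE] : exists q, b' = D * q.
  by apply: primitive_dvdp => //; rewrite -(dvdpZl _ _ k0) -DE dvdp_gcdr.
have [c [cca ccb cm]] := gcdR ca cb.
have [ra raE] := cca; have [rb rbE] := ccb.
exists (c *: D); split.
- by exists (ra *: qa); rewrite aE raE qaE -!scalerAl -scalerAr scalerA.
- by exists (rb *: qb); rewrite bE rbE qbE -!scalerAl -scalerAr scalerA.
move=> h [u uE] [v vE].
have h0 : h != 0 by apply: contraNneq a0 => h0; rewrite uE h0 mul0r.
have [ch [h' [ch0 hE ph]]] := primitive_part gcdR h0.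
have [s sE] : divides ch c.
  apply: cm.
    by apply: pa => i; rewrite -coefZ -aE uE hE -scalerAl coefZ; exists (h' * u)`_i.
  by apply: pb => i; rewrite -coefZ -bE vE hE -scalerAl coefZ; exists (h' * v)`_i.
have [t tE] : exists t, D = h' * t.
  apply: primitive_dvdp => //; rewrite -(dvdpZr _ _ k0) -DE dvdp_gcd.
  apply/andP; split.
    by rewrite -(dvdpZr _ _ ca0) -aE uE hE -scalerAl dvdpZr // dvdp_mulr.
  by rewrite -(dvdpZr _ _ cb0) -bE vE hE -scalerAl dvdpZr // dvdp_mulr.
by exists (s *: t); rewrite hE tE sE -scalerAl -scalerAr scalerA.
Qed.

Lemma gcd_domain_iso (R S : idomainType) (phi : {rmorphism R -> S}) :
  bijective phi -> gcd_domain S -> gcd_domain R.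
Proof.
move=> [psi phiK psiK] gcdS a b.
have psiM x y : psi (x * y) = psi x * psi y.
  by apply: (can_inj phiK); rewrite rmorphM !psiK.
have [g [[q ga] [r gb] gm]] := gcdS (phi a) (phi b).
exists (psi g); split.
- by exists (psi q); rewrite -psiM -ga phiK.
- by exists (psi r); rewrite -psiM -gb phiK.
move=> h [u ha] [v hb].
have [w wE] : divides (phi h) g.
  by apply: gm; [exists (phi u) | exists (phi v)]; rewrite -rmorphM -?ha -?hb.
by exists (psi w); rewrite wE psiM phiK.
Qed.

Lemma gcd_domain_field (F : fieldType) : gcd_domain F.
Proof.
move=> a b; have unit_div (x y : F) : x != 0 -> divides x y.
  by move=> ord_s; exists (x^-1 * y); rewrite mulrA mulfV // mul1r.
have [a0 | a0] := eqVneq a 0.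
  by exists b; split=> //; [rewrite a0; apply: divides0 | apply: divides_refl].
by exists a; split=> //; [apply: divides_refl | apply: unit_div].
Qed.

(** * Splitting off the last variable *)

Section Muni.
Variables (n : nat) (R : idomainType).

Definition mrestr (m : 'X_{1..n.+1}) : 'X_{1..n} :=
  [multinom m (widen_ord (leqnSn n) i) | i < n].

Lemma mrestr_inj (m m' : 'X_{1..n.+1}) :
  mrestr m = mrestr m' -> m ord_max = m' ord_max -> m = m'.
Proof.
move=> /mnmP e el; apply/mnmP => i; have [j -> | ->] := unliftP ord_max i; last exact: el.
have -> : lift ord_max j = widen_ord (leqnSn n) j.
  by apply: val_inj; rewrite /= /bump leqNgt ltn_ord.
by have := e j; rewrite !mnmE.
Qed.

Lemma muniX (m : 'X_{1..n.+1}) :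
  muni ('X_[m] : {mpoly R[n.+1]}) = ('X_[mrestr m])%:P * 'X^(m ord_max).
Proof. by rewrite muniE msuppX big_seq1 mcoeffX eqxx scale1r mul_polyC. Qed.

Lemma mcoeff_muni (p : {mpoly R[n.+1]}) (m : 'X_{1..n.+1}) :
  ((muni p)`_(m ord_max))@_(mrestr m) = p@_m.
Proof.
rewrite {1}[p]mpolyE !raddf_sum coef_sum raddf_sum [p in RHS]mpolyE raddf_sum.
apply: eq_bigr => m' _; rewrite /= muniZ muniX coefZ mul_mpolyC coefCM coefXn !mcoeffZ mcoeffX.
case: (eqVneq m' m) => [-> | ne]; first by rewrite eqxx mulr1 mcoeffX eqxx.
case: eqP => el; last by rewrite mulr0 mcoeff0.
rewrite mulr1 mcoeffX; case: eqP => // er; case/eqP: ne; exact: mrestr_inj.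
Qed.

Lemma muni_inj : injective (@muni n R).
Proof. by move=> p q e; apply/mpolyP => m; rewrite -!mcoeff_muni e. Qed.

Lemma mrestr_widen (m : 'X_{1..n}) : mrestr (mnmwiden m) = m.
Proof. by apply/mnmP => i; rewrite mnmE mnmwiden_widen. Qed.

Lemma muni_widen (c : {mpoly R[n]}) : muni (mwiden c) = c%:P.
Proof.
elim/mpolyind: c => [|c m p _ _ IH]; first by rewrite mwiden0 muni0.
rewrite mwidenD muniD IH polyCD mwidenZ mwidenX muniZ muniX mrestr_widen mnmwiden_ordmax expr0 mulr1.
by rewrite -[c *: 'X_[m]]mul_mpolyC polyCM mul_polyC.
Qed.

Lemma muni_max : muni ('X_ord_max : {mpoly R[n.+1]}) = 'X.
Proof.
rewrite muniX mnmE eqxx expr1 (_ : mrestr _ = 0%MM) ?mpolyX0 ?mul1r //.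
apply/mnmP => i; rewrite !mnmE -val_eqE /= gtn_eqF //.
Qed.

Lemma muni_bij : bijective (@muni n R).
Proof.
have K : cancel (@mmulti n R) (@muni n R).
  move=> p; rewrite /mmulti raddf_sum /= -[RHS]coefK poly_def.
  apply: eq_bigr => i _.
  by rewrite muniM muni_widen rmorphXn /= muni_max mul_polyC.
by exists (@mmulti n R) => // p; apply: muni_inj; rewrite K.
Qed.

End Muni.

Lemma gcd_domain_mpoly (F : fieldType) n : gcd_domain {mpoly F[n]}.
Proof.
elim: n => [|n IH]; last first.
  exact: gcd_domain_iso (@muni_bij n F) (gcd_domain_poly IH).
apply: (gcd_domain_iso (phi := @mcoeff 0 F 0%MM) _ (@gcd_domain_field F)).
by exists (@mpolyC 0 F); [exact: mpolyKC | exact: mpolyCK].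
Qed.

(** * Elimination *)

Section Ideal.
Variables (F : fieldType) (m : nat) (f : 'I_m -> {mpoly F[3]}).
Local Notation J := (ideal_gen f).

Lemma ideal_gen0 : J 0.
Proof. by exists (fun=> 0); rewrite big1 // => i _; rewrite mul0r. Qed.

Lemma ideal_genD p q : J p -> J q -> J (p + q).
Proof.
move=> [c ->] [e ->]; exists (fun i => c i + e i); rewrite -big_split /=.
by apply: eq_bigr => i _; rewrite mulrDl.
Qed.

Lemma ideal_genM a p : J p -> J (a * p).
Proof.
move=> [c ->]; exists (fun i => a * c i); rewrite mulr_sumr.
by apply: eq_bigr => i _; rewrite mulrA.
Qed.

Lemma ideal_genN p : J p -> J (- p).
Proof. by move=> Jp; rewrite -mulN1r; apply: ideal_genM. Qed.

Lemma ideal_genB p q : J p -> J q -> J (p - q).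
Proof. by move=> Jp Jq; apply: ideal_genD => //; apply: ideal_genN. Qed.

Lemma ideal_genZ (a : F) p : J p -> J (a *: p).
Proof. by move=> Jp; rewrite -mul_mpolyC; apply: ideal_genM. Qed.

Lemma ideal_gen_sum (I : Type) (s : seq I) (P : pred I) (p : I -> {mpoly F[3]}) :
  (forall i, P i -> J (p i)) -> J (\sum_(i <- s | P i) p i).
Proof. by move=> H; elim/big_ind: _ => //; [apply: ideal_gen0 | apply: ideal_genD]. Qed.

Lemma ideal_gen_mem i : J (f i).
Proof.
exists (fun j => (j == i)%:R); rewrite (bigD1 i) //= eqxx mul1r big1 ?addr0 //.
by move=> j /negbTE ->; rewrite mul0r.
Qed.

End Ideal.

Lemma mcoeff_pihomog n (R : ringType) d (p : {mpoly R[n]}) m :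
  (pihomog mdeg d p)@_m = if mdeg m == d then p@_m else 0.
Proof.
elim/mpolyind: p => [|c k p _ _ IH]; first by rewrite pihomog0 mcoeff0 if_same.
rewrite linearP /= mcoeffD mcoeffZ pihomogX IH mcoeffD mcoeffZ mcoeffX.
case: (eqVneq k m) => [-> | ne].
  by case: ifP => _; rewrite ?mcoeffX ?eqxx // mcoeff0 mulr0 addr0.
case: ifP => _; first by rewrite mcoeffX (negbTE ne) mulr0 !add0r.
by rewrite mcoeff0 mulr0 !add0r.
Qed.

Lemma pihomogM n (R : idomainType) d e (p q : {mpoly R[n]}) : q \is e.-homog ->
  pihomog mdeg d (p * q) = if (e <= d)%N then pihomog mdeg (d - e) p * q else 0.
Proof.
move=> hq; elim/mpolyind: p => [|c k p _ _ IH].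
  by rewrite !(mul0r, pihomog0) if_same.
have hk : 'X_[k] * q \is (mdeg k + e).-homog by apply: dhomogM; rewrite ?dhomogX.
rewrite mulrDl -scalerAl !linearP /= IH pihomogX.
have -> : pihomog mdeg d ('X_[k] * q) = if (mdeg k + e == d)%N then 'X_[k] * q else 0.
  case: eqP => [<- | /eqP ne]; first by rewrite pihomog_dE.
  exact: (pihomog_ne0 ne hk).
case: leqP => led; last first.
  rewrite addr0; case: eqP => [de | _]; first lia. exact: scaler0.
have -> : (mdeg k + e == d)%N = (mdeg k == d - e)%N by apply/eqP/eqP; lia.
case: ifP => _; first by rewrite mulrDl -scalerAl.
by rewrite (_ : c *: 0 = 0) ?add0r //; apply: scaler0.
Qed.

Section HomogIdeal.
Variables (F : fieldType) (m : nat) (f : 'I_m -> {mpoly F[3]}) (e : 'I_m -> nat).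
Hypothesis fh : forall i, f i \is (e i).-homog.
Local Notation J := (ideal_gen f).

(** Keeping only the component of degree [k - e i] of each coefficient preserves the identity. The
    case [k < e i] is separate because there the subtraction truncates. *)
Lemma ideal_gen_coefs k p : J p -> p \is k.-homog -> exists c : 'I_m -> {mpoly F[3]},
  [/\ p = \sum_i c i * f i, forall i, (e i <= k)%N -> c i \is (k - e i).-homog &
      forall i, (k < e i)%N -> c i = 0].
Proof.
move=> [c pE] hp.
exists (fun i => if (e i <= k)%N then pihomog mdeg (k - e i) (c i) else 0); split.
- rewrite -[LHS](pihomog_dE hp) pE raddf_sum; apply: eq_bigr => i _ /=.
  by rewrite (pihomogM _ _ (fh i)); case: ifP => _; rewrite ?mul0r.
- by move=> i ->; apply: pihomogP.
- by move=> i; rewrite ltnNge => /negbTE ->.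
Qed.

Lemma ideal_gen_pihomog k p : J p -> J (pihomog mdeg k p).
Proof.
move=> [c ->]; rewrite raddf_sum; apply: ideal_gen_sum => i _ /=.
rewrite (pihomogM _ _ (fh i)); case: ifP => _; last exact: ideal_gen0.
exact/ideal_genM/ideal_gen_mem.
Qed.

End HomogIdeal.

Lemma exists_minimal (T : Type) (P : T -> Prop) (mu : T -> nat) :
  (exists x, P x) -> exists x, P x /\ forall y, P y -> (mu x <= mu y)%N.
Proof.
move=> [x Px]; have [N] := ubnP (mu x); elim: N x Px => // N IH x Px.
rewrite ltnS => sx; have [[y [Py sy]] | H] := classic (exists y, P y /\ (mu y < mu x)%N).
  by apply: (IH y Py); apply: leq_trans sy sx.
exists x; split=> // y Py; rewrite leqNgt; apply/negP => sy; case: H; by exists y.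
Qed.

Section Elimination.
Variables (F : fieldType) (m : nat).
Implicit Types f : 'I_m -> {mpoly F[3]}.

Lemma gcd_one_neq0 f : gcd_one f -> exists i, f i != 0.
Proof.
move=> cop; apply: NNPP => H.
have [] : punit (0 : {mpoly F[3]}).
  apply: cop => i; exists 0; rewrite mul0r; apply/eqP; apply: contraT => fi.
  by case: H; exists i.
by move=> u /eqP; rewrite mul0r eq_sym oner_eq0.
Qed.

Lemma gcd_one_coprime f : gcd_one f ->
  forall c h, (forall i, divides h (c * f i)) -> divides h c.
Proof.
move=> cop; apply: (gcd_domain_coprime (@gcd_domain_mpoly F 3)) => h H.
by have [u uE] := cop h H; exists u.
Qed.

(** Take a nonzero [D] in the ideal of least degree in the last variable. Pseudo-division of [f i]
    by [D] leaves remainder 0, so [D] divides [c i * f i] with [c i] free of that variable. Then [D]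
    divides [C * f i] for the product [C] of all [c i], hence divides [C] by coprimality, and so is
    itself free of that variable. *)
Lemma elimination_max f : gcd_one f -> exists r,
  [/\ ideal_gen f r, r != 0 & forall k, k \in msupp r -> k ord_max = 0%N].
Proof.
move=> cop; have [i0 fi0] := gcd_one_neq0 cop.
have [|D [[JD D0] Dmin]] := @exists_minimal _
  (fun D => ideal_gen f D /\ D != 0) (fun D => size (muni D)).
  by exists (f i0); split=> //; apply: ideal_gen_mem.
have mD0 : muni D != 0 by rewrite -(inj_eq (@muni_inj 2 F)) muni0 in D0.
have key i : exists c : {mpoly F[2]}, c != 0 /\ divides D (mwiden c * f i).
  pose c := lead_coef (muni D) ^+ scalp (muni (f i)) (muni D).
  have [psi psiK muniK] := muni_bij 2 F.
  exists c; split; first by rewrite expf_neq0 // lead_coef_eq0.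
  have := Pdiv.Idomain.divp_eq (muni (f i)) (muni D).
  rewrite -/c -mul_polyC -muni_widen -muniM => e.
  have rE : muni (mwiden c * f i - psi (muni (f i) %/ muni D) * D) =
      muni (f i) %% muni D.
    by rewrite muniB e muniM muniK addrC addKr.
  have /eqP : mwiden c * f i - psi (muni (f i) %/ muni D) * D = 0.
    apply/eqP; apply: contraT => n0; have := ltn_modp (muni (f i)) (muni D).
    rewrite mD0 -rE ltnNge Dmin //; split=> //.
    by apply: ideal_genB; apply: ideal_genM => //; apply: ideal_gen_mem.
  by rewrite subr_eq0 mulrC => /eqP ->; exists (psi (muni (f i) %/ muni D)); rewrite mulrC.
have [c cP] : exists c : 'I_m -> {mpoly F[2]},
    forall i, c i != 0 /\ divides D (mwiden (c i) * f i).
  by apply: (fin_all_exists key).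
pose C := \prod_i c i.
have C0 : C != 0 by apply/prodf_neq0 => i _; case: (cP i).
have [w wE] : divides D (mwiden C).
  apply: (gcd_one_coprime cop) => i; rewrite /C (bigD1 i) //= mwidenM mulrAC.
  by apply: divides_mulr; case: (cP i).
have sD : (size (muni D) <= 1)%N.
  have w0 : muni w != 0.
    rewrite -(muni0 2 F) (inj_eq (@muni_inj 2 F)); apply: contraNneq C0 => w0.
    by rewrite -polyC_eq0 -muni_widen wE w0 mulr0 muni0.
  have : size (muni D * muni w) = 1%N by rewrite -muniM -wE muni_widen size_polyC C0.
  move: (muni D) (muni w) mD0 w0 => P Q P0 Q0; rewrite (size_mul P0 Q0).
  move: Q0; rewrite -size_poly_gt0; case: (size Q) => // k _.
  by rewrite addnS /= => e; apply: leq_trans (leq_addr k _) _; rewrite e.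
exists D; split=> // k; rewrite mcoeff_msupp -mcoeff_muni; case: (k ord_max) => // l.
by rewrite nth_default ?mcoeff0 ?eqxx // (leq_trans sD).
Qed.

Lemma elimination f (e : 'I_m -> nat) (j : 'I_3) :
    gcd_one f -> (forall i, f i \is (e i).-homog) ->
  exists n r, [/\ ideal_gen f r, r != 0, r \is n.-homog &
                  forall k, k \in msupp r -> k j = 0%N].
Proof.
move=> cop fh; pose s := tperm j ord_max.
have sK : involutive (msym s : {mpoly F[3]} -> _).
  by move=> p; rewrite -msymMm tperm2 msym1m.
have [|r [[c rE] r0 rsupp]] := @elimination_max (fun i => msym s (f i)).
  move=> h H; have [i|u uE] := cop (msym s h).
    by have [q qE] := H i; exists (msym s q); rewrite -msymM -qE sK.
  by exists (msym s u); rewrite -[h]sK -msymM uE msym1.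
pose r' := msym s r.
have Jr' : ideal_gen f r'.
  exists (fun i => msym s (c i)); rewrite /r' rE raddf_sum.
  by apply: eq_bigr => i _ /=; rewrite msymM sK.
have r'supp k : k \in msupp r' -> k j = 0%N.
  rewrite mcoeff_msupp mcoeff_sym -mcoeff_msupp => /rsupp.
  by rewrite mnmE tpermR.
have r'0 : r' != 0 by apply: contraNneq r0 => r'0; rewrite -[r]sK -/r' r'0 msym0.
(* The homogeneous component containing the leading monomial is nonzero, lies in the ideal, and
   inherits the support condition. *)
pose k := mlead r'; exists (mdeg k), (pihomog mdeg (mdeg k) r'); split.
- exact: ideal_gen_pihomog fh _ _ Jr'.
- have : r'@_k != 0 by rewrite mleadc_eq0.
  by apply: contraNneq => /(congr1 (mcoeff k)); rewrite mcoeff_pihomog eqxx mcoeff0 => ->.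
- exact: pihomogP.
- move=> l; rewrite mcoeff_msupp mcoeff_pihomog; case: ifP; last by rewrite eqxx.
  by move=> _; rewrite -mcoeff_msupp; apply: r'supp.
Qed.

End Elimination.

(** * An infinite extension with a linear retraction *)

Section FractionRepr.
Variable R : idomainType.

Lemma fraction_reprM (x : {fraction R}) :
  x * FracField.tofrac \d_(repr x) = FracField.tofrac \n_(repr x).
Proof.
rewrite -{1}[x]reprK; move: (repr x) => z; unlock FracField.tofrac.
rewrite -[LHS]FracField.pi_mul; apply/eqmodP; rewrite /= FracField.equivfE /FracField.mulf.
by rewrite !numden_Ratio ?mulf_neq0 ?oner_neq0 ?denom_ratioP // !mulr1 mulrC.
Qed.

End FractionRepr.

Section Retraction.
Variable F : fieldType.
Local Notation K := {fraction {poly F}}.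
Local Notation tf := (@FracField.tofrac {poly F}).

(* The constant term of the polynomial part: an F-linear retraction of F(X) onto F. *)
Definition rat_const (x : K) : F := (\n_(repr x) %/ \d_(repr x))`_0.

(** The Euclidean quotient is unchanged when numerator and denominator are multiplied by the same
    polynomial, so [rat_const] may be computed on any fraction representing [x]. *)
Lemma rat_constE (x : K) (a b : {poly F}) : b != 0 -> x * tf b = tf a ->
  rat_const x = (a %/ b)`_0.
Proof.
move=> b0 e; rewrite /rat_const; have := fraction_reprM x.
have := denom_ratioP (repr x); move: (frac (repr x)) => [n d] /= d0 en.
have : tf (n * b) = tf (a * d) by rewrite !tofracM -en -e mulrAC.
move/eqP; rewrite tofrac_eq => /eqP h; congr (_ `_ 0).
have e1 : n %/ d = n * b %/ (d * b) by rewrite divp_pmul2r.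
by rewrite e1 h [d * b]mulrC divp_pmul2r.
Qed.

Lemma rat_const_is_zmod_morphism : zmod_morphism rat_const.
Proof.
move=> x y; have hx := fraction_reprM x; have hy := fraction_reprM y.
have := denom_ratioP (repr x); have := denom_ratioP (repr y).
move: (frac (repr x)) (frac (repr y)) hx hy => [a b] [c d] /= hx hy d0 b0.
have bd0 : b * d != 0 by rewrite mulf_neq0.
have -> : rat_const (x - y) = ((a * d - c * b) %/ (b * d))`_0.
  apply: rat_constE => //; rewrite tofracB !tofracM -hx -hy.
  by rewrite mulrBl mulrA -[y * _ * _]mulrA [tf d * tf b]mulrC.
rewrite (rat_constE b0 hx) (rat_constE d0 hy) divpD divpN coefB.
by rewrite divp_pmul2r // [b * d]mulrC divp_pmul2r.
Qed.

HB.instance Definition _ :=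
  GRing.isZmodMorphism.Build K F rat_const rat_const_is_zmod_morphism.

Lemma rat_constM (c : F) (x : K) : rat_const (tf c%:P * x) = c * rat_const x.
Proof.
have hx := fraction_reprM x; have b0 := denom_ratioP (repr x).
rewrite (rat_constE b0 hx) (@rat_constE _ (c *: \n_(repr x)) _ b0).
  by rewrite divpZl coefZ.
by rewrite -mulrA hx -tofracM mul_polyC.
Qed.

Lemma rat_const1 : rat_const 1 = 1.
Proof.
by rewrite (@rat_constE 1 1 1) ?oner_eq0 ?mulr1 // divpp ?oner_eq0 // coef1.
Qed.

Lemma rat_function_infinite (s : seq K) : exists x, x \notin s.
Proof.
pose t := [seq tf 'X^i | i <- iota 0 (size s).+1].
have ut : uniq t.
  rewrite map_inj_uniq ?iota_uniq // => i j /eqP; rewrite tofrac_eq => /eqP e.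
  by have := congr1 (fun p : {poly F} => size p) e; rewrite !size_polyXn => -[].
have [x xt xs] : exists2 x, x \in t & x \notin s.
  apply/allPn; apply/negP => /allP /(uniq_leq_size ut).
  by rewrite size_map size_iota ltnn.
by exists x.
Qed.

End Retraction.

(** * Generic specialisations *)

Section GenericCoprime.
Variable K : fieldType.

Lemma roots_finite (p : {poly K}) : p != 0 -> exists s : seq K, forall x, root p x -> x \in s.
Proof.
have [n] := ubnP (size p); elim: n p => // n IH p; rewrite ltnS => sp p0.
have [[a ra] | H] := classic (exists a, root p a); last first.
  by exists [::] => x rx; case: H; exists x.
have /factor_theorem [q pE] := ra.
have q0 : q != 0 by apply: contraNneq p0 => q0; rewrite pE q0 mul0r.
have [|s sP] := IH q _ q0.
  by apply: leq_trans sp; rewrite pE size_Mmonic ?monicXsubC // size_XsubC addn2.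
exists (a :: s) => x; rewrite pE rootM root_XsubC inE => /orP [/sP -> | ->] //.
by rewrite orbT.
Qed.

(* If [al] has no proper divisor, [al %| B.[mu%:P]] is a nontrivial polynomial
   equation on [mu]; otherwise split [al]. *)
Lemma generic_coprime (al : {poly K}) (B : {poly {poly K}}) : al != 0 ->
    (forall D, D %| al -> (forall i, D %| B`_i) -> size D = 1%N) ->
  exists s : seq K, forall mu, mu \notin s -> coprimep al B.[mu%:P].
Proof.
have [n] := ubnP (size al); elim: n al => // n IH al; rewrite ltnS => sal al0 H.
have [[D [Dal D1 sD]] | irr] :=
    classic (exists D, [/\ D %| al, size D != 1%N & (size D < size al)%N]).
  have /dvdpP [E alE] := Dal.
  have /norP [E0 D0] : ~~ ((E == 0) || (D == 0)) by rewrite -mulf_eq0 -alE.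
  have sE : (size E < size al)%N.
    rewrite alE size_mul //; move: D1 E0 D0; rewrite -!size_poly_gt0.
    by case: (size D) => [|[|k]] // _ _ _; rewrite addnS /= addnS ltnS leq_addr.
  have [||s1 s1P] := IH D _ D0 _; first exact: leq_trans sD sal.
    by move=> G GD; apply: H; apply: dvdp_trans Dal.
  have [||s2 s2P] := IH E _ E0 _; first exact: leq_trans sE sal.
    by move=> G GE; apply: H; rewrite alE dvdp_mulr.
  exists (s1 ++ s2) => mu; rewrite mem_cat => /norP [m1 m2].
  by rewrite alE coprimepMl s1P // s2P.
have [s1 | s1] := eqVneq (size al) 1%N.
  exists [::] => mu _; apply: (@coprimep_dvdr _ 1); last exact: coprime1p.
  by rewrite dvdp1 s1.
have [i Bi] : exists i, ~~ (al %| B`_i).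
  apply: NNPP => N; case/eqP: s1; apply: H => // i.
  by apply: contraT => Bi; case: N; exists i.
have [j Rj] : exists j, (B`_i %% al)`_j != 0.
  exists (size (B`_i %% al)).-1; rewrite -/(lead_coef _) lead_coef_eq0.
  by apply: contra Bi => /eqP e; apply/modp_eq0P.
(* The coefficient of degree [j] of the remainder of [B.[mu%:P]] modulo [al] is the polynomial [P]
   in [mu]; the choice of [i] and [j] makes [P] nonzero. *)
pose P := \poly_(k < size B) (B`_k %% al)`_j.
have P0 : P != 0.
  apply: contraNneq Rj => /(congr1 (fun p : {poly K} => p`_i)).
  rewrite coef_poly coef0; case: ltnP => [_ -> //| hi].
  by move=> _; rewrite [B`_i](nth_default _ hi) mod0p coef0.
have [s sP] := roots_finite P0; exists s => mu mus.
apply: contraT => ncop; case/negP: mus; apply: sP.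
have Gal := dvdp_gcdl al B.[mu%:P].
have sG : size (gcdp al B.[mu%:P]) = size al.
  apply/eqP; rewrite eqn_leq dvdp_leq //= leqNgt; apply/negP => lt; apply: irr.
  by exists (gcdp al B.[mu%:P]); split.
have alB : al %| B.[mu%:P].
  apply: dvdp_trans (dvdp_gcdr al _).
  by move: sG => /eqP; rewrite dvdp_size_eqp // => /andP [].
rewrite /root; apply/eqP.
transitivity ((B.[mu%:P] %% al)`_j); last by rewrite (modp_eq0 alB) coef0.
rewrite /P horner_poly horner_coef.
rewrite (big_morph (fun p => p %% al) (modpD al) (mod0p al)) coef_sum.
apply: eq_bigr => k _.
by rewrite -polyC_exp [B`_k * _]mulrC mul_polyC modpZl coefZ mulrC.
Qed.

Lemma lead_coef_comp_shift (b : {poly K}) (g : {poly K}) : b != 0 ->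
  lead_coef ((b^:P) \Po ('X + g%:P)) = (lead_coef b)%:P.
Proof.
move=> b0; rewrite lead_coef_comp ?size_XaddC // lead_coefXaddC expr1n mulr1.
by rewrite lead_coef_map_inj //; apply: polyC_inj.
Qed.

(** As a polynomial in [mu], [b \Po (g + mu%:P)] has the leading coefficient of [b], a nonzero
    constant; so no nonconstant factor of [al] divides all its coefficients. *)
Lemma generic_shift_coprime (al b g : {poly K}) : al != 0 -> b != 0 ->
  exists s : seq K, forall mu, mu \notin s -> coprimep al (b \Po (g + mu%:P)).
Proof.
move=> al0 b0; have [|s sP] := @generic_coprime al ((b^:P) \Po ('X + g%:P)) al0.
  move=> D Dal H.
  have : D %| (lead_coef b)%:P by rewrite -(lead_coef_comp_shift g b0); apply: H.
  move/dvdp_leq; rewrite polyC_eq0 lead_coef_eq0 size_polyC lead_coef_eq0 b0 => /(_ isT).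
  have : D != 0 by apply: contraNneq al0 => D0; rewrite -dvd0p -D0.
  by rewrite -size_poly_gt0; case: (size D) => [|[|k]].
exists s => mu /sP; rewrite horner_comp hornerD hornerX hornerC.
by rewrite addrC.
Qed.

End GenericCoprime.

Section HomogInd.
Variables (n : nat) (R : idomainType).

(** Forms are combinations of monomials, and a monomial of positive degree is a variable times one
    of degree one less. *)
Lemma homog_ind (P : nat -> {mpoly R[n]} -> Prop) :
    P 0%N 1 ->
    (forall k i p, p \is k.-homog -> P k p -> P k.+1 ('X_i * p)) ->
    (forall k, P k 0) -> (forall k c p q, P k p -> P k q -> P k (c *: p + q)) ->
  forall k p, p \is k.-homog -> P k p.
Proof.
move=> P1 PX P0 PD.
have Pm k m : mdeg m = k -> P k 'X_[m].
  elim: k m => [|k IH] m.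
    by move/eqP; rewrite mdeg_eq0 => /eqP ->; rewrite mpolyX0.
  move=> dm; have [i mi] : exists i, m i != 0%N.
    apply: NNPP => H; suff m0 : m = 0%MM by rewrite m0 mdeg0 in dm.
    apply/mnmP => i; rewrite mnm0E; apply/eqP; apply: contraT => mi.
    by case: H; exists i.
  have mE : m = (U_(i) + (m - U_(i)))%MM.
    by rewrite addmC submK // lep1mP.
  have dm' : mdeg (m - U_(i))%MM = k.
    by move: dm; rewrite {1}mE mdegD mdeg1 => -[].
  rewrite mE mpolyXD; apply: PX; last exact: IH.
  by rewrite dhomogX; apply/eqP.
move=> k p hp; rewrite [p]mpolyE big_seq.
elim/big_ind: _ => //; first by move=> x y Px Py; rewrite -[x]scale1r; apply: PD.
move=> m mp; rewrite -[_ *: _]addr0; apply: PD => //.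
by apply: Pm; apply: (dhomog_mf hp).
Qed.

End HomogInd.

(** * Restriction to a line *)

Definition ord_s : 'I_3 := inord 0.
Definition ord_t : 'I_3 := inord 1.
Definition ord_u : 'I_3 := inord 2.

Lemma ord3P (P : 'I_3 -> Prop) : P ord_s -> P ord_t -> P ord_u -> forall i, P i.
Proof.
move=> P0 P1 P2 i; have : [|| i == ord_s, i == ord_t | i == ord_u].
  by case: i => [] [|[|[|]]] // hi; rewrite -!val_eqE /= !inordK.
by case/or3P => /eqP ->.
Qed.

Lemma ord_ts : (ord_t == ord_s) = false. Proof. by rewrite -val_eqE /= !inordK. Qed.
Lemma ord_us : (ord_u == ord_s) = false. Proof. by rewrite -val_eqE /= !inordK. Qed.
Lemma ord_ut : (ord_u == ord_t) = false. Proof. by rewrite -val_eqE /= !inordK. Qed.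
Lemma ord_st : (ord_s == ord_t) = false. Proof. by rewrite eq_sym ord_ts. Qed.
Lemma ord_su : (ord_s == ord_u) = false. Proof. by rewrite eq_sym ord_us. Qed.
Lemma ord_tu : (ord_t == ord_u) = false. Proof. by rewrite eq_sym ord_ut. Qed.
Definition ord_neq := (ord_ts, ord_us, ord_ut, ord_st, ord_su, ord_tu).

Lemma mdeg3 (k : 'X_{1..3}) : mdeg k = (k ord_s + k ord_t + k ord_u)%N.
Proof.
rewrite mdegE !big_ord_recl big_ord0 addn0 addnA.
by congr (k _ + k _ + k _)%N; apply: val_inj; rewrite /= inordK.
Qed.

Lemma homog_varX (R : idomainType) n (i : 'I_n) k : ('X_i ^+ k : {mpoly R[n]}) \is k.-homog.
Proof. by rewrite mpolyXn dhomogX /= mdegMn mdeg1 mul1n. Qed.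

Section Line.
Variables (K : fieldType) (la mu : K).
Local Notation T := {mpoly K[3]}.

(** The line [u = la * s + mu * t] parametrised by [s] in the chart [t = 1]; [line_inf] is its only
    point with [t = 0]. *)
Definition line_pt (i : 'I_3) : {poly K} :=
  if i == ord_s then 'X else if i == ord_t then 1 else la *: 'X + mu%:P.
Definition line_inf (i : 'I_3) : K :=
  if i == ord_s then 1 else if i == ord_t then 0 else la.
Definition line_form : T := 'X_ord_u - la *: 'X_ord_s - mu *: 'X_ord_t.

(* Restriction to the line [line_form = 0], in the affine coordinate s/t;
   [homogenize k] is its section on forms of degree [k], and the coefficient of
   ['X^k] is the value at the point [line_inf] at infinity. *)
Definition restr (p : T) : {poly K} := mmap (@polyC K) line_pt p.
HB.instance Definition _ := GRing.RMorphism.copy restr (mmap (@polyC K) line_pt).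

Definition homogenize k (q : {poly K}) : T :=
  \sum_(i < k.+1) q`_i *: ('X_ord_s ^+ i * 'X_ord_t ^+ (k - i)).

Lemma restrX i : restr 'X_i = line_pt i.
Proof. by rewrite /restr mmapX mmap1U. Qed.

Lemma restrZ c p : restr (c *: p) = c *: restr p.
Proof. by rewrite /restr mmapZ mul_polyC. Qed.

Lemma restr_line_form : restr line_form = 0.
Proof.
rewrite /line_form !rmorphB /= !restrZ !restrX /line_pt !ord_neq !eqxx.
by rewrite alg_polyC addrAC addrK subrr.
Qed.

Lemma homogenize_homog k q : homogenize k q \is k.-homog.
Proof.
apply: rpred_sum => i _; apply: rpredZ.
have := dhomogM (homog_varX K ord_s i) (homog_varX K ord_t (k - i)).
by rewrite subnKC // -ltnS.
Qed.

Lemma homogenize_is_linear k : linear (homogenize k).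
Proof.
move=> c p q; rewrite /homogenize scaler_sumr -big_split; apply: eq_bigr => i _ /=.
by rewrite coefD coefZ scalerDl scalerA.
Qed.
HB.instance Definition _ k := GRing.isLinear.Build K {poly K} T _ (homogenize k)
  (homogenize_is_linear k).

Lemma restr_homogenize k (q : {poly K}) : (size q <= k.+1)%N -> restr (homogenize k q) = q.
Proof.
move=> sq; have -> : restr (homogenize k q) = \poly_(i < k.+1) q`_i.
  rewrite /homogenize raddf_sum poly_def; apply: eq_bigr => i _ /=.
  rewrite restrZ rmorphM !rmorphXn /= !restrX /line_pt !ord_neq !eqxx expr1n.
  by rewrite mulr1.
apply/polyP => j; rewrite coef_poly; case: ltnP => // hj.
by rewrite nth_default // (leq_trans sq).
Qed.

Lemma homogenizeX k q : homogenize k.+1 ('X * q) = 'X_ord_s * homogenize k q.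
Proof.
rewrite /homogenize big_ord_recl coefXM /= scale0r add0r mulr_sumr.
by apply: eq_bigr => i _; rewrite coefXM /= subSS -scalerAr exprS mulrA.
Qed.

Lemma homogenizeS k (q : {poly K}) : (size q <= k.+1)%N ->
  homogenize k.+1 q = 'X_ord_t * homogenize k q.
Proof.
move=> sq; rewrite /homogenize big_ord_recr /= nth_default // scale0r addr0 mulr_sumr.
apply: eq_bigr => i _; have ik : (i <= k)%N by rewrite -ltnS.
by rewrite (subSn ik) exprS -scalerAr; congr (_ *: _); rewrite mulrCA.
Qed.

Lemma restr_homog k p : p \is k.-homog ->
  [/\ (size (restr p) <= k.+1)%N, (restr p)`_k = p.@[line_inf] &
   exists w, p = homogenize k (restr p) + line_form * w].
Proof.
move: k p; apply: homog_ind.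
- rewrite rmorph1 size_poly1 coef1 meval1; split=> //; exists 0.
  by rewrite mulr0 addr0 /homogenize big_ord1 coef1 subnn !expr0 mulr1 scale1r.
- move=> k i p hp [sp tp [w pE]]; rewrite rmorphM /= restrX mevalM mevalXU.
  have tp' : (restr p)`_k.+1 = 0 by rewrite nth_default.
  have sXp : (size ('X * restr p)%R <= k.+2)%N.
    by rewrite (leq_trans (size_polyMleq _ _)) // size_polyX.
  elim/ord3P: i; rewrite /line_pt /line_inf !ord_neq ?eqxx.
  + rewrite coefXM /= tp mul1r; split=> //; exists ('X_ord_s * w).
    by rewrite {1}pE homogenizeX; ring.
  + rewrite mul1r mul0r tp' (leq_trans sp) //; split=> //; exists ('X_ord_t * w).
    by rewrite {1}pE homogenizeS //; ring.
  rewrite mulrDl -scalerAl mul_polyC coefD !coefZ coefXM /= tp tp' mulr0 addr0.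
  split=> //.
    rewrite (leq_trans (size_polyD _ _)) // geq_max.
    by rewrite !(leq_trans (size_scale_leq _ _)) // (leq_trans sp).
  (* Substituting [u = line_form + la * s + mu * t] in front of [homogenize k (restr p)] produces
     the additional cofactor. *)
  exists (homogenize k (restr p) + 'X_ord_u * w).
  rewrite {1}pE linearD !linearZ /= homogenizeX homogenizeS // /line_form.
  by rewrite -!mul_mpolyC; ring.
- move=> k; rewrite raddf0 size_poly0 coef0 meval0; split=> //.
  by exists 0; rewrite mulr0 addr0 raddf0.
move=> k c p q [sp tp [w pE]] [sq tq [v qE]].
rewrite raddfD /= restrZ; split.
- rewrite (leq_trans (size_polyD _ _)) // geq_max sq andbT.
  exact: leq_trans (size_scale_leq _ _) sp.
- by rewrite coefD coefZ tp tq mevalD mevalZ.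
exists (c *: w + v).
by rewrite {1}pE {1}qE linearP /= -!mul_mpolyC; ring.
Qed.

Lemma line_form_homog : line_form \is 1.-homog.
Proof. by rewrite !rpredB ?rpredZ //; apply: (homog_varX K _ 1). Qed.

Lemma restr_homog_mod k p : p \is k.+1.-homog ->
  exists2 w, w \is k.-homog & p = homogenize k.+1 (restr p) + line_form * w.
Proof.
move=> hp; have [_ _ [w pE]] := restr_homog hp.
exists (pihomog mdeg k w); first exact: pihomogP.
rewrite -[LHS](pihomog_dE hp) {1}pE raddfD /= pihomog_dE ?homogenize_homog //.
by rewrite [line_form * w]mulrC (pihomogM _ _ line_form_homog) /= subn1 mulrC.
Qed.

Lemma restr_eq0_mod k p : p \is k.-homog -> restr p = 0 ->
  exists2 w, w \is k.-1.-homog & p = line_form * w.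
Proof.
case: k => [|k] hp p0; last first.
  by have [w hw ->] := restr_homog_mod hp; exists w; rewrite // p0 raddf0 add0r.
(* In degree 0 the form vanishes, since a multiple of [line_form] has no component of degree 0. *)
exists 0; first exact: rpred0.
have [_ _ [w pE]] := restr_homog hp.
have := pihomog_dE hp; rewrite {1}pE p0 raddf0 add0r mulrC.
by rewrite (pihomogM _ _ line_form_homog) mulr0.
Qed.

End Line.

(** * Regular sequences made of two forms and a linear form *)

Section RegularPair.
Variables (K : fieldType) (la mu : K) (d : nat) (a b : {mpoly K[3]}).
Local Notation T := {mpoly K[3]}.
Local Notation restr := (restr la mu).
Local Notation ell := (line_form la mu).
Hypotheses (ha : a \is d.-homog) (hb : b \is d.-homog).
Hypotheses (sa : size (restr a) = d.+1) (cop : coprimep (restr a) (restr b)).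

Let al0 : restr a != 0.
Proof. by rewrite -size_poly_eq0 sa. Qed.

Lemma line_form_neq0 : ell != 0.
Proof.
apply/eqP => /(congr1 (mcoeff U_(ord_u)%MM)).
rewrite /line_form !mcoeffB !mcoeffZ !mcoeffXU mcoeff0 !ord_neq eqxx !mulr0 !subr0.
by apply/eqP; rewrite oner_eq0.
Qed.

(** On the line, Bezout writes the restriction [P] of [p] as [z0 * al + y0 * be], where [y0] is
    reduced modulo [al] and so has degree below [d]. As [2 * d - 1 <= k], the product [y0 * be] has
    degree at most [k], and since [al] has degree exactly [d], [z0] has degree at most [k - d]. Both
    lift to forms, and the difference vanishes on the line. *)
Lemma regular_pair_top k p : p \is k.-homog -> (2 * d <= k.+1)%N -> (0 < d)%N ->
  exists x y w, [/\ x \is (k - d).-homog, y \is (k - d).-homog, w \is k.-1.-homog &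
                    p = x * a + y * b + ell * w].
Proof.
move=> hp hk d0; have [sp _ _] := restr_homog la mu hp.
have [sb _ _] := restr_homog la mu hb.
have /Bezout_eq1_coprimepP [[u v] /= uv] := cop.
move: al0 sa sb uv; set al := restr a; set be := restr b => al0' sal sb uv.
pose P := restr p; pose y0 := (v * P) %% al; pose z0 := u * P + (v * P) %/ al * be.
have e : z0 * al + y0 * be = P.
  have h := divp_eq (v * P) al.
  transitivity ((u * al + v * be) * P); last by rewrite uv mul1r.
  have hh : v * P * be = ((v * P) %/ al * al + y0) * be by rewrite /y0 -h.
  transitivity (u * P * al + v * P * be); last by ring.
  by rewrite hh /z0; ring.
have sy : (size y0 <= d)%N by rewrite -ltnS -sal ltn_modp.
have sz : (size z0 <= (k - d).+1)%N.
  have [-> | z0N] := eqVneq z0 0; first by rewrite size_poly0.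
  have : (size (z0 * al)%R <= k.+1)%N.
    rewrite -(addrK (y0 * be) (z0 * al)) e (leq_trans (size_polyD _ _)) //.
    rewrite size_polyN geq_max sp (leq_trans (size_polyMleq _ _)) //.
    move: sy sb hk; move: (size y0) (size be) => i j; lia.
  rewrite size_mul // sal; move: (size z0) => i; lia.
have sy' : (size y0 <= (k - d).+1)%N by apply: leq_trans sy _; lia.
have hkd : ((k - d) + d = k)%N by lia.
pose x := homogenize (k - d) z0; pose y := homogenize (k - d) y0.
have hx : x \is (k - d).-homog by apply: homogenize_homog.
have hy : y \is (k - d).-homog by apply: homogenize_homog.
have hq : p - (x * a + y * b) \is k.-homog.
  by rewrite rpredB // rpredD // -hkd; apply: dhomogM.
have [|w hw wE] := restr_eq0_mod (la := la) (mu := mu) hq.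
  rewrite rmorphB rmorphD !rmorphM /= !restr_homogenize //.
  by rewrite e subrr.
by exists x, y, w; split=> //; rewrite -wE addrC subrK.
Qed.

(** On the line, [(A, B)] is a syzygy of two coprime polynomials, hence a multiple [ga] of the
    trivial one. Subtracting the trivial syzygy of [a] and [b] with a lift [C] of [ga] makes both
    coefficients divisible by the linear form, which is then cancelled. *)
Lemma regular_pair_nzd j p A B : A \is j.-homog -> B \is j.-homog ->
  ell * p = A * a + B * b -> exists A' B', p = A' * a + B' * b.
Proof.
move=> hA hB e.
have e0 : restr A * restr a + restr B * restr b = 0.
  by rewrite -!rmorphM -rmorphD -e rmorphM /= restr_line_form mul0r.
have /dvdpP [ga gaE] : restr a %| restr B.
  rewrite -(Gauss_dvdpl _ cop); apply/dvdpP; exists (- restr A).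
  by apply/eqP; rewrite mulNr -addr_eq0 addrC e0.
have AE : restr A = - (ga * restr b).
  apply: (mulIf al0); apply/eqP; rewrite mulNr -addr_eq0 -e0 gaE; apply/eqP; ring.
(* If [ga] is nonzero, comparing degrees in [restr B = ga * restr a] forces [d <= j], so [j - d] is
   a true degree. Otherwise [C = 0] serves whatever [j] is. *)
have [C [hC1 hC2 rC]] : exists C, [/\ C * a \is j.-homog, C * b \is j.-homog & restr C = ga].
  have [-> | ga0] := eqVneq ga 0.
    by exists 0; rewrite !mul0r !rpred0 raddf0.
  have [sB _ _] := restr_homog la mu hB.
  move: sB; rewrite gaE size_mul // sa => sB.
  have sg : (0 < size ga)%N by rewrite size_poly_gt0.
  have [hj sj] : ((j - d) + d = j)%N /\ (size ga <= (j - d).+1)%N.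
    by move: (size ga) sB sg => k; lia.
  have hC : homogenize (j - d) ga \is (j - d).-homog by apply: homogenize_homog.
  exists (homogenize (j - d) ga); rewrite -{2 4}hj; split; try exact: dhomogM.
  exact: restr_homogenize.
have [A' _ A'E] : exists2 A', A' \is j.-1.-homog & A + C * b = ell * A'.
  by apply: restr_eq0_mod; rewrite ?rpredD // rmorphD rmorphM /= AE rC addNr.
have [B' _ B'E] : exists2 B', B' \is j.-1.-homog & B - C * a = ell * B'.
  by apply: restr_eq0_mod; rewrite ?rpredB // rmorphB rmorphM /= gaE rC subrr.
exists A', B'; apply: (mulfI line_form_neq0); rewrite e mulrDr !mulrA -A'E -B'E; ring.
Qed.

Variables (m : nat) (f : 'I_m -> T) (e : 'I_m -> nat).
Hypotheses (fh : forall i, f i \is (e i).-homog) (ed : forall i, (e i <= d)%N).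
Hypotheses (d_gt0 : (0 < d)%N) (Ja : ideal_gen f a) (Jb : ideal_gen f b).
Local Notation J := (ideal_gen f).

Lemma line_form_nzd_ideal k p : p \is k.-homog -> (3 * d - 2 <= k)%N -> J (ell * p) -> J p.
Proof.
move=> hp hk Jp.
have hlp : ell * p \is k.+1.-homog by apply: (dhomogM (line_form_homog la mu) hp).
have [c [cE ch _]] := ideal_gen_coefs fh Jp hlp.
have key i : exists w : T * T * T, [/\ w.1.1 \is (k.+1 - e i - d).-homog,
    w.1.2 \is (k.+1 - e i - d).-homog & c i = w.1.1 * a + w.1.2 * b + ell * w.2].
  have ei := ed i.
  have hci : c i \is (k.+1 - e i).-homog by apply: ch; lia.
  (* This is the origin of the bound [3 * d - 2]: with [e i <= d] it puts each coefficient in degree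
     at least [2 * d - 1]. *)
  have hdi : (2 * d <= (k.+1 - e i).+1)%N by lia.
  have [x [y [w [hx hy _ cE']]]] := regular_pair_top hci hdi d_gt0.
  by exists (x, y, w).
have [w wP] := fin_all_exists key.
pose X := \sum_i (w i).1.1 * f i; pose Y := \sum_i (w i).1.2 * f i.
have deg i : (k.+1 - e i - d + e i = k.+1 - d)%N by have := ed i; lia.
have hX : X \is (k.+1 - d).-homog.
  by apply: rpred_sum => i _; rewrite -(deg i); apply: dhomogM => //; case: (wP i).
have hY : Y \is (k.+1 - d).-homog.
  by apply: rpred_sum => i _; rewrite -(deg i); apply: dhomogM => //; case: (wP i).
(* The linear form times [p - \sum_i (w i).2 * f i] equals [X * a + Y * b], and [X], [Y] have the
   same degree because each [f i] restores the degree its coefficient lost. *)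
have [|A' [B' pE]] := @regular_pair_nzd _ (p - \sum_i (w i).2 * f i) _ _ hX hY.
  rewrite mulrBr cE /X /Y !mulr_suml mulr_sumr -sumrB -big_split /=.
  by apply: eq_bigr => i _; have [_ _ ->] := wP i; ring.
rewrite -[p](subrK (\sum_i (w i).2 * f i)) pE; apply: ideal_genD.
  by apply: ideal_genD; apply: ideal_genM.
by exists (fun i => (w i).2).
Qed.

(** Let [q] be the linear form evaluated at [(x, y, z)]. The hypotheses give [ell * x = s * q]
    modulo [J], and likewise for [y], [z]. In this degree [q = ell * w] modulo [J], so
    [ell * (x - s * w)] lies in [J], and [ell] can be cancelled. *)
Lemma koszul_mod_ideal k x y z : x \is k.-homog -> y \is k.-homog -> z \is k.-homog ->
    (3 * d - 2 <= k)%N -> J ('X_ord_s * y - 'X_ord_t * x) -> J ('X_ord_s * z - 'X_ord_u * x) ->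
    J ('X_ord_t * z - 'X_ord_u * y) ->
  exists w, [/\ J (x - 'X_ord_s * w), J (y - 'X_ord_t * w) & J (z - 'X_ord_u * w)].
Proof.
move=> hx hy hz hk Jxy Jxz Jyz.
pose q := z - la *: x - mu *: y.
have hq : q \is k.-homog by rewrite !rpredB ?rpredZ.
have hdk : (2 * d <= k.+1)%N by lia.
have [X [Y [w [_ _ hw qE]]]] := regular_pair_top hq hdk d_gt0.
have hXw i : 'X_i * w \is k.-homog.
  have := dhomogM (homog_varX K i 1) hw; rewrite add1n prednK //; lia.
have JXY : J (X * a + Y * b) by apply: ideal_genD; apply: ideal_genM.
have lE : ell * w = q - (X * a + Y * b) by rewrite qE [RHS]addrC addKr.
have red i v : v \is k.-homog -> J (ell * v - 'X_i * q) -> J (v - 'X_i * w).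
  move=> hv Jv; apply: (line_form_nzd_ideal (rpredB hv (hXw i)) hk).
  have -> : ell * (v - 'X_i * w) = (ell * v - 'X_i * q) + 'X_i * (X * a + Y * b).
    by rewrite mulrBr [ell * (_ * w)]mulrCA lE; ring.
  by apply: ideal_genD => //; apply: ideal_genM.
exists w; split; apply: red => //; rewrite /line_form /q -!mul_mpolyC.
- have -> : ('X_ord_u - la%:MP * 'X_ord_s - mu%:MP * 'X_ord_t) * x -
      'X_ord_s * (z - la%:MP * x - mu%:MP * y) =
      mu%:MP * ('X_ord_s * y - 'X_ord_t * x) - ('X_ord_s * z - 'X_ord_u * x) by ring.
  by apply: ideal_genB => //; apply: ideal_genM.
- have -> : ('X_ord_u - la%:MP * 'X_ord_s - mu%:MP * 'X_ord_t) * y -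
      'X_ord_t * (z - la%:MP * x - mu%:MP * y) =
      - (la%:MP * ('X_ord_s * y - 'X_ord_t * x)) - ('X_ord_t * z - 'X_ord_u * y) by ring.
  by apply: ideal_genB => //; apply: ideal_genN; apply: ideal_genM.
have -> : ('X_ord_u - la%:MP * 'X_ord_s - mu%:MP * 'X_ord_t) * z -
    'X_ord_u * (z - la%:MP * x - mu%:MP * y) =
    - (la%:MP * ('X_ord_s * z - 'X_ord_u * x)) - mu%:MP * ('X_ord_t * z - 'X_ord_u * y) by ring.
by apply: ideal_genB; [apply: ideal_genN|]; apply: ideal_genM.
Qed.

End RegularPair.

Lemma mnm3_inj (i j : 'I_3) (k l : 'X_{1..3}) :
  j != i -> k i = l i -> k j = l j -> mdeg k = mdeg l -> k = l.
Proof.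
rewrite !mdeg3; move=> ji ei ej ed; apply/mnmP.
move: i j ji ei ej; apply: ord3P; apply: ord3P; rewrite ?ord_neq ?eqxx // => _ ei ej;
  apply: ord3P => //; lia.
Qed.

(** * Existence of a regular pair over an infinite field *)

Section CoordPoly.
Variable K : fieldType.
Implicit Types r : {mpoly K[3]}.

Lemma eq_mmap_msupp (S : comRingType) (phi : {rmorphism K -> S}) (h1 h2 : 'I_3 -> S) r :
    (forall m k, m \in msupp r -> m k != 0%N -> h1 k = h2 k) ->
  mmap phi h1 r = mmap phi h2 r.
Proof.
move=> H; rewrite /mmap big_seq [RHS]big_seq; apply: eq_bigr => m mr; congr (_ * _).
apply: eq_bigr => k _; have [-> | mk] := eqVneq (m k) 0%N; first by rewrite !expr0.
by rewrite (H m).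
Qed.

Definition coord_poly (j : 'I_3) r : {poly K} :=
  mmap (@polyC K) (fun k => if k == j then 'X else 1) r.

Lemma coord_polyE j r : coord_poly j r = \sum_(m <- msupp r) r@_m *: 'X^(m j).
Proof.
apply: eq_bigr => m _; rewrite mul_polyC; congr (_ *: _).
rewrite /mmap1 (bigD1 j) //= eqxx big1 ?mulr1 // => k /negbTE ->.
by rewrite expr1n.
Qed.

Lemma coord_poly_comp (g : {poly K}) j r :
  coord_poly j r \Po g = mmap (@polyC K) (fun k => if k == j then g else 1) r.
Proof.
rewrite coord_polyE raddf_sum; apply: eq_bigr => m _ /=.
rewrite linearZ /= rmorphXn /= comp_polyX mul_polyC; congr (_ *: _).
rewrite /mmap1 (bigD1 j) //= eqxx big1 ?mulr1 // => k /negbTE ->.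
by rewrite expr1n.
Qed.

Lemma coord_poly_horner (x : K) j r :
  (coord_poly j r).[x] = r.@[fun k => if k == j then x else 1].
Proof.
rewrite coord_polyE horner_sum mevalE; apply: eq_bigr => m _.
rewrite hornerZ hornerXn; congr (_ * _).
rewrite (bigD1 j) //= eqxx big1 ?mulr1 // => k /negbTE ->.
by rewrite expr1n.
Qed.

(** Monomials of equal degree that omit the variable [i] are separated by their exponent at [j], so
    setting the other variables to 1 causes no cancellation. *)
Lemma coord_poly_neq0 n r i j : r \is n.-homog -> r != 0 -> j != i ->
  (forall m, m \in msupp r -> m i = 0%N) -> coord_poly j r != 0.
Proof.
move=> hr r0 ji supp; have lr := mlead_supp r0.
have : (coord_poly j r)`_(mlead r j) = r@_(mlead r).
  rewrite coord_polyE coef_sum (bigD1_seq (mlead r)) ?msupp_uniq //=.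
  rewrite coefZ coefXn eqxx mulr1 big_seq_cond big1 ?addr0 // => m /andP [mr mm].
  rewrite coefZ coefXn; case: eqP => ej; last by rewrite mulr0.
  case/eqP: mm; have ei := etrans (supp _ mr) (esym (supp _ lr)).
  have ed := etrans (dhomog_mf hr mr) (esym (dhomog_mf hr lr)).
  exact: mnm3_inj ji ei (esym ej) ed.
move=> e; apply: contraNneq r0 => p0.
by rewrite -mleadc_eq0 -e p0 coef0.
Qed.

End CoordPoly.

Section RegularPairExists.
Variable K : fieldType.
Hypothesis K_inf : forall s : seq K, exists x, x \notin s.
Variables (m d : nat) (f : 'I_m -> {mpoly K[3]}) (e : 'I_m -> nat).
Hypotheses (fh : forall i, f i \is (e i).-homog) (ed : forall i, (e i <= d)%N).
Hypothesis eliminants : forall i : 'I_3, exists n r, [/\ ideal_gen f r, r != 0, r \is n.-homog &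
  forall k, k \in msupp r -> k i = 0%N].

(** The eliminant omitting [t] is nonzero at [(1, 0, la)] for generic [la], so some generator is
    nonzero there. In the chart [t = 1], the eliminants omitting [u] and [s] restrict to a
    polynomial in [s] and to a polynomial in [la * s + mu]; these are coprime for generic [mu],
    which excludes common factors of the generators. *)
Lemma regular_line : exists la mu,
  (forall D, (forall i, D %| restr la mu (f i)) -> size D = 1%N) /\
  (exists i, (f i).@[line_inf la] != 0).
Proof.
have [n0 [r [[c rE] rN hr rsupp]]] := eliminants ord_u.
have [n1 [r' [[c' rE'] rN' hr' rsupp']]] := eliminants ord_s.
have [n2 [r'' [[c'' rE''] rN'' hr'' rsupp'']]] := eliminants ord_t.
have b''0 : coord_poly ord_u r'' != 0 by exact: coord_poly_neq0 hr'' rN'' (negbT ord_ut) rsupp''.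
have [s sP] := roots_finite b''0; have [la las] := K_inf s.
have al0 : coord_poly ord_s r != 0 by exact: coord_poly_neq0 hr rN (negbT ord_su) rsupp.
have b0 : coord_poly ord_u r' != 0 by exact: coord_poly_neq0 hr' rN' (negbT ord_us) rsupp'.
have [t tP] := generic_shift_coprime (la *: 'X) al0 b0.
have [mu mut] := K_inf t; exists la, mu; split.
  move=> D HD; apply/eqP; rewrite size_poly_eq1.
  have Ddvd p : ideal_gen f p -> D %| restr la mu p.
    move=> [g ->]; rewrite raddf_sum; elim/big_ind: _ => [|x y|i _].
    - exact: dvdp0.
    - exact: dvdp_add.
    - by rewrite /= rmorphM; apply: dvdp_mull; apply: HD.
  have /coprimepP := tP _ mut; apply.
    have -> : coord_poly ord_s r = restr la mu r.
      apply: eq_mmap_msupp => k; apply: ord3P; rewrite /line_pt ?ord_neq ?eqxx //.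
      by move=> /rsupp ->.
    by apply: Ddvd; exists c.
  have -> : coord_poly ord_u r' \Po (la *: 'X + mu%:P) = restr la mu r'.
    rewrite coord_poly_comp.
    apply: eq_mmap_msupp => k; apply: ord3P; rewrite /line_pt ?ord_neq ?eqxx //.
    by move=> /rsupp' ->.
  by apply: Ddvd; exists c'.
apply: NNPP => H; have fi i : (f i).@[line_inf la] = 0.
  by apply/eqP; apply: contraT => fi; case: H; exists i.
have : (coord_poly ord_u r'').[la] != 0 by apply/negP => rt; case/negP: las; apply: sP.
rewrite coord_poly_horner; case/eqP.
have -> : r''.@[fun k => if k == ord_u then la else 1] = r''.@[line_inf la].
  apply: (@eq_mmap_msupp K K idfun) => k; apply: ord3P; rewrite /line_inf ?ord_neq ?eqxx //.
  by move=> /rsupp'' ->.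
by rewrite rE'' raddf_sum big1 // => i _; rewrite /= mevalM fi mulr0.
Qed.

Lemma regular_pair_exists : exists la mu a b, [/\ ideal_gen f a, ideal_gen f b,
  a \is d.-homog, b \is d.-homog &
  size (restr la mu a) = d.+1 /\ coprimep (restr la mu a) (restr la mu b)].
Proof.
have [la [mu [cop [i0 fi0]]]] := regular_line; exists la, mu.
(* The coordinate [s] is 1 at [line_inf], so [a] is nonzero there and its restriction has degree
   exactly [d]. *)
pose a := 'X_ord_s ^+ (d - e i0) * f i0.
have Ja : ideal_gen f a by apply/ideal_genM/ideal_gen_mem.
have hX j i : 'X_j ^+ (d - e i) * f i \is d.-homog.
  by have := dhomogM (homog_varX K j (d - e i)) (fh i); rewrite subnK.
have sa : size (restr la mu a) = d.+1.
  have [sa ta _] := restr_homog la mu (hX ord_s i0).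
  apply/eqP; rewrite eqn_leq sa ltnNge; apply/negP => lt.
  case/eqP: fi0; move: ta; rewrite nth_default // mevalM rmorphXn /= mevalXU.
  by rewrite /line_inf eqxx expr1n mul1r.
have al0 : restr la mu a != 0 by rewrite -size_poly_eq0 sa.
(* The second form is a combination of the generators with coefficients the powers of one parameter
   [nu], so that a single generic value suffices. Its padding factors are powers of [t], which
   restrict to 1. *)
have [|s sP] := @generic_coprime K _ (\poly_(i < m) (if insub i is Some j then restr la mu (f j) else 0)) al0.
  move=> D _ HD; apply: cop => i; have := HD i; rewrite coef_poly ltn_ord.
  by rewrite insubT // => hi; rewrite (_ : Sub _ _ = i) //; apply: val_inj.
have [nu nus] := K_inf s.
exists a, (\sum_(i < m) nu ^+ i *: ('X_ord_t ^+ (d - e i) * f i)); split=> //.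
- by apply: ideal_gen_sum => i _; apply: ideal_genZ; apply/ideal_genM/ideal_gen_mem.
- exact: hX.
- by apply: rpred_sum => i _; apply: rpredZ; apply: hX.
split=> //; have := sP _ nus; rewrite horner_poly; congr coprimep.
rewrite raddf_sum; apply: eq_bigr => i _ /=.
rewrite restrZ rmorphM rmorphXn /= restrX /line_pt ord_neq eqxx expr1n mul1r.
rewrite -polyC_exp mulrC mul_polyC; congr (_ *: _).
by rewrite insubT // => hi; rewrite (_ : Sub _ _ = i) //; apply: val_inj.
Qed.

End RegularPairExists.

(** * Descent to the base field *)

Section Descent.
Variable F : fieldType.
Local Notation K := {fraction {poly F}}.

Definition const_rat (c : F) : K := @FracField.tofrac {poly F} c%:P.

Lemma const_rat_is_zmod_morphism : zmod_morphism const_rat.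
Proof. by move=> a b; rewrite /const_rat rmorphB tofracB. Qed.
HB.instance Definition _ :=
  GRing.isZmodMorphism.Build F K const_rat const_rat_is_zmod_morphism.

Lemma const_rat_is_monoid_morphism : monoid_morphism const_rat.
Proof. by split=> [|a b]; rewrite /const_rat ?rmorph1 // rmorphM tofracM. Qed.
HB.instance Definition _ :=
  GRing.isMonoidMorphism.Build F K const_rat const_rat_is_monoid_morphism.

Local Notation ext := (@map_mpoly 3 F K const_rat).
Local Notation ret := (@map_mpoly 3 K F (@rat_const F)).

Lemma ext_homog k p : p \is k.-homog -> ext p \is k.-homog.
Proof.
move=> hp; apply/dhomogP => l; rewrite mcoeff_msupp mcoeff_map_mpoly => pl.
apply: (dhomog_mf hp); rewrite mcoeff_msupp.
by apply: contraNneq pl => ->; rewrite raddf0.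
Qed.

Lemma ret_monom (a : K) k : ret (a *: 'X_[k]) = rat_const a *: 'X_[k].
Proof.
apply/mpolyP => l; rewrite mcoeff_map_mpoly !mcoeffZ !mcoeffX.
by case: eqP => _; rewrite ?mulr1 // !mulr0 raddf0.
Qed.

Lemma extD p q : ext (p + q) = ext p + ext q. Proof. exact: raddfD. Qed.
Lemma retD p q : ret (p + q) = ret p + ret q. Proof. exact: raddfD. Qed.
Lemma ext0 : ext 0 = 0. Proof. exact: raddf0. Qed.
Lemma ret0 : ret 0 = 0. Proof. exact: raddf0. Qed.
Lemma extM p q : ext (p * q) = ext p * ext q. Proof. exact: rmorphM. Qed.
Lemma extB p q : ext (p - q) = ext p - ext q. Proof. exact: raddfB. Qed.
Lemma retB p q : ret (p - q) = ret p - ret q. Proof. exact: raddfB. Qed.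

Lemma ret_monomM (a : K) (b : F) k l :
  ret ((a *: 'X_[k]) * (const_rat b *: 'X_[l])) = (rat_const a *: 'X_[k]) * (b *: 'X_[l]).
Proof.
have h (R : comRingType) (x y : R) : (x *: 'X_[k]) * (y *: 'X_[l]) =
    (x * y) *: 'X_[k + l] :> {mpoly R[3]}.
  by rewrite -scalerAl -scalerAr scalerA -mpolyXD.
by rewrite !h ret_monom mulrC rat_constM mulrC.
Qed.

(** The retraction is not multiplicative, but it is linear over the polynomials with coefficients in
    [F]; this is enough to carry ideal membership back to [F]. *)
Lemma retM (c : {mpoly K[3]}) (p : {mpoly F[3]}) : ret (c * ext p) = ret c * p.
Proof.
elim/mpolyind: p => [|b l p _ _ IHp]; first by rewrite ext0 !mulr0 ret0.
rewrite extD (mulrDr c) retD (mulrDr (ret c)).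
congr (_ + _); last exact: IHp.
clear p IHp.
rewrite map_mpolyZ map_mpolyX.
elim/mpolyind: c => [|a k c _ _ IHc]; first by rewrite ret0 !mul0r ret0.
rewrite mulrDl retD retD mulrDl; congr (_ + _); last exact: IHc.
by rewrite ret_monomM ret_monom.
Qed.

Lemma ret1 : ret 1 = 1.
Proof.
apply/mpolyP => l; rewrite mcoeff_map_mpoly !mcoeff1.
by case: eqP => _; [exact: rat_const1 | exact: raddf0].
Qed.

Lemma extK p : ret (ext p) = p.
Proof. by rewrite -[ext p]mul1r retM ret1 mul1r. Qed.

Lemma extX i : ext 'X_i = 'X_i.
Proof. exact: map_mpolyX. Qed.

Variables (m d : nat) (f : 'I_m -> {mpoly F[3]}) (e : 'I_m -> nat).
Hypotheses (fh : forall i, f i \is (e i).-homog) (ed : forall i, (e i <= d)%N).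
Hypotheses (d_gt0 : (0 < d)%N) (cop : gcd_one f).
Local Notation J := (ideal_gen f).
Local Notation JK := (ideal_gen (fun i => ext (f i))).

Lemma ideal_gen_ext p : J p -> JK (ext p).
Proof.
move=> [c ->]; exists (fun i => ext (c i)); rewrite raddf_sum.
by apply: eq_bigr => i _; rewrite /= extM.
Qed.

Lemma ideal_gen_ret q : JK q -> J (ret q).
Proof.
move=> [c ->]; exists (fun i => ret (c i)); rewrite raddf_sum.
by apply: eq_bigr => i _; rewrite /= retM.
Qed.

Lemma elimination_ext (i : 'I_3) : exists n r, [/\ JK r, r != 0, r \is n.-homog &
  forall k, k \in msupp r -> k i = 0%N].
Proof.
have [n [r [Jr r0 hr rs]]] := elimination i cop fh.
exists n, (ext r); split; [exact: ideal_gen_ext | | exact: ext_homog |].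
  by apply: contraNneq r0 => r0; rewrite -[r]extK r0 ret0.
move=> k; rewrite mcoeff_msupp mcoeff_map_mpoly => rk; apply: rs.
by rewrite mcoeff_msupp; apply: contraNneq rk => ->; rewrite raddf0.
Qed.

Lemma regular_pair_ext : exists la mu a b, [/\ JK a, JK b,
  a \is d.-homog, b \is d.-homog &
  size (restr la mu a) = d.+1 /\ coprimep (restr la mu a) (restr la mu b)].
Proof.
exact: (regular_pair_exists (@rat_function_infinite F)
  (fun i => ext_homog (fh i)) ed elimination_ext).
Qed.

(** An element killed by all variables modulo [J] is killed by the linear form over the extension,
    which is a nonzerodivisor in these degrees. *)
Lemma socle_bound k p : p \is k.-homog -> (3 * d - 2 <= k)%N ->
  (forall i, J ('X_i * p)) -> J p.
Proof.
move=> hp hk Jp; have [la [mu [a [b [Ja Jb ha hb [sa ab]]]]]] := regular_pair_ext.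
rewrite -[p]extK; apply: ideal_gen_ret.
apply: (line_form_nzd_ideal ha hb sa ab (fun i => ext_homog (fh i)) ed d_gt0 Ja Jb
  (ext_homog hp) hk).
have JX i : JK ('X_i * ext p) by rewrite -extX -extM; apply: ideal_gen_ext.
rewrite /line_form !mulrBl -!scalerAl; apply: ideal_genB; last exact: ideal_genZ.
by apply: ideal_genB => //; apply: ideal_genZ.
Qed.

Lemma koszul_bound k x y z : x \is k.-homog -> y \is k.-homog -> z \is k.-homog ->
    (3 * d - 2 <= k)%N -> J ('X_ord_s * y - 'X_ord_t * x) -> J ('X_ord_s * z - 'X_ord_u * x) ->
    J ('X_ord_t * z - 'X_ord_u * y) ->
  exists w, [/\ J (x - 'X_ord_s * w), J (y - 'X_ord_t * w) & J (z - 'X_ord_u * w)].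
Proof.
move=> hx hy hz hk Jxy Jxz Jyz.
have [la [mu [a [b [Ja Jb ha hb [sa ab]]]]]] := regular_pair_ext.
have JX i j u v : J ('X_i * u - 'X_j * v) -> JK ('X_i * ext u - 'X_j * ext v).
  by move/ideal_gen_ext; rewrite extB !extM !extX.
have [w [Jx Jy Jz]] := koszul_mod_ideal ha hb sa ab (fun i => ext_homog (fh i)) ed
  d_gt0 Ja Jb (ext_homog hx) (ext_homog hy) (ext_homog hz) hk
  (JX _ _ _ _ Jxy) (JX _ _ _ _ Jxz) (JX _ _ _ _ Jyz).
(* Only [w] lives over the extension; [ret w] replaces it because [ret] fixes [v] and commutes with
   the variables. *)
have red i v : JK (ext v - 'X_i * w) -> J (v - 'X_i * ret w).
  by move/ideal_gen_ret; rewrite retB extK mulrC -extX retM mulrC.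
by exists (ret w); split; apply: red.
Qed.

End Descent.

(** * Koszul relations *)

Section Shift.
Variable F : fieldType.
Local Notation T := {mpoly F[3]}.
Implicit Types (p q : T) (k : 'X_{1..3}) (i j : 'I_3).

Lemma mcoeffXM i p k : ('X_i * p)@_k = if k i == 0%N then 0 else p@_(k - U_(i)).
Proof.
rewrite mulrC; case: eqP => ki.
  apply: memN_msupp_eq0; apply/negP.
  rewrite (perm_mem (msuppMX p U_(i)%MM)) => /mapP [l _ kE].
  by move: ki; rewrite kE mnmDE mnm1E eqxx.
have {1}-> : k = (U_(i) + (k - U_(i)))%MM.
  by rewrite addmC submK // lep1mP; apply/eqP.
exact: mcoeffMX.
Qed.

(** Quotient and, with [kill_var], remainder of the division by the variable [i]. *)
Definition shift_down i p : T := \sum_(k <- msupp p | k i != 0%N) p@_k *: 'X_[k - U_(i)].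
Definition kill_var i p : T := \sum_(k <- msupp p | k i == 0%N) p@_k *: 'X_[k].

Lemma mcoeff_kill_var i p k : (kill_var i p)@_k = if k i == 0%N then p@_k else 0.
Proof.
rewrite /kill_var raddf_sum /=.
have [kp | kp] := boolP (k \in msupp p); last first.
  rewrite (memN_msupp_eq0 kp) if_same big_seq_cond big1 // => l /andP [lp _].
  rewrite mcoeffZ mcoeffX; case: eqP => [e | _]; last by rewrite mulr0.
  by rewrite -e lp in kp.
rewrite big_mkcond (bigD1_seq k) ?msupp_uniq //= big1 ?addr0; last first.
  by move=> l lk; case: ifP => // _; rewrite mcoeffZ mcoeffX (negbTE lk) mulr0.
by case: ifP => //; rewrite mcoeffZ mcoeffX eqxx mulr1.
Qed.

Lemma shift_downK i p : p = 'X_i * shift_down i p + kill_var i p.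
Proof.
rewrite {1}[p]mpolyE (bigID (fun k : 'X_{1..3} => k i != 0%N)) /=.
congr (_ + _); last by apply: eq_bigl => k; rewrite negbK.
rewrite mulr_sumr; apply: eq_bigr => k ki; rewrite -scalerAr -mpolyXD.
by rewrite addmC submK // lep1mP.
Qed.

Lemma mcoeff_shift_down i p k : (shift_down i p)@_k = p@_(k + U_(i)).
Proof.
rewrite [p in RHS](shift_downK i) mcoeffD mcoeffXM mcoeff_kill_var.
by rewrite mnmDE mnm1E eqxx /= addn1 /= addr0 addmK.
Qed.

Lemma kill_varM i p : kill_var i ('X_i * p) = 0.
Proof.
by apply/mpolyP => k; rewrite mcoeff_kill_var mcoeffXM mcoeff0; case: (k i == 0%N).
Qed.

Lemma kill_varMX i j p : j != i -> kill_var i ('X_j * p) = 'X_j * kill_var i p.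
Proof.
move=> ji; apply/mpolyP => k; rewrite mcoeff_kill_var !mcoeffXM mcoeff_kill_var.
by rewrite mnmBE mnm1E (negbTE ji) subn0; do 2!case: ifP.
Qed.

Lemma kill_varD i p q : kill_var i (p + q) = kill_var i p + kill_var i q.
Proof.
apply/mpolyP => k; rewrite mcoeffD !mcoeff_kill_var mcoeffD.
by case: ifP => //; rewrite addr0.
Qed.

Lemma kill_var0 i : kill_var i 0 = 0.
Proof. by apply/mpolyP => k; rewrite mcoeff_kill_var mcoeff0 if_same. Qed.

Lemma var_neq0 i : 'X_i != 0 :> T.
Proof. by rewrite -msize_poly_eq0 msizeX. Qed.

(* [p] is homogeneous of degree [n] as an element of [T(-a)]; stating this on
   the support avoids truncated subtractions. *)
Definition homog_shift n a p := forall k, p@_k != 0 -> (mdeg k + a = n)%N.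

Lemma homog_shiftP n a p : homog_shift n a p -> p \is (n - a).-homog.
Proof.
by move=> h; apply/dhomogP => k; rewrite mcoeff_msupp => /h /=; lia.
Qed.

Lemma homog_shift0 n a : homog_shift n a 0.
Proof. by move=> k; rewrite mcoeff0 eqxx. Qed.

Lemma homog_shiftD n a p q : homog_shift n a p -> homog_shift n a q -> homog_shift n a (p + q).
Proof.
move=> hp hq k; rewrite mcoeffD => pq.
have [p0 | /hp //] := eqVneq p@_k 0; apply: hq.
by apply: contraNneq pq => q0; rewrite p0 q0 addr0.
Qed.

Lemma homog_shift_sum n a (I : Type) (s : seq I) (P : pred I) (p : I -> T) :
  (forall x, P x -> homog_shift n a (p x)) -> homog_shift n a (\sum_(x <- s | P x) p x).
Proof.
by move=> h; elim/big_ind: _ => //; [apply: homog_shift0 | apply: homog_shiftD].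
Qed.

Lemma homog_shiftM n a b c p q : homog_shift b a p -> homog_shift n (b + c) q ->
  homog_shift n (a + c) (p * q).
Proof.
move=> hp hq k; rewrite -mcoeff_msupp => /msuppM_le /allpairsP [[k1 k2] /= []].
by rewrite !mcoeff_msupp => /hp h1 /hq h2 ->; rewrite mdegD; lia.
Qed.

Lemma homog_shift_down n a i p : homog_shift n a p -> homog_shift n a.+1 (shift_down i p).
Proof. by move=> h k; rewrite mcoeff_shift_down => /h; rewrite mdegD mdeg1; lia. Qed.

Lemma homog_shift_kill n a i p : homog_shift n a p -> homog_shift n a (kill_var i p).
Proof. by move=> h k; rewrite mcoeff_kill_var; case: ifP => _; [apply: h | rewrite eqxx]. Qed.

Lemma homog_shiftN n a p : homog_shift n a p -> homog_shift n a (- p).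
Proof. by move=> h k; rewrite mcoeffN oppr_eq0; apply: h. Qed.

(** Dividing successively by [s], [t] and [u] leaves only the constant term as remainder. *)
Lemma koszul0 n a p : homog_shift n a p -> p@_0%MM = 0 -> exists x y z,
  [/\ homog_shift n a.+1 x, homog_shift n a.+1 y, homog_shift n a.+1 z &
      p = 'X_ord_s * x + 'X_ord_t * y + 'X_ord_u * z].
Proof.
move=> hp p0; pose p1 := kill_var ord_s p; pose p2 := kill_var ord_t p1.
have h1 : homog_shift n a p1 by apply: homog_shift_kill.
have h2 : homog_shift n a p2 by apply: homog_shift_kill.
exists (shift_down ord_s p), (shift_down ord_t p1), (shift_down ord_u p2); split;
  try exact: homog_shift_down.
rewrite {1}(shift_downK ord_s p) -/p1 {1}(shift_downK ord_t p1) -/p2 {1}(shift_downK ord_u p2).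
suff -> : kill_var ord_u p2 = 0 by ring.
apply/mpolyP => k; rewrite !mcoeff_kill_var mcoeff0.
case: eqP => // k2; case: eqP => // k1; case: eqP => // k0.
by rewrite (_ : k = 0%MM) //; apply/mnmP; apply: ord3P; rewrite mnm0E.
Qed.

(** Setting [s] and [t] to 0 in the relation shows that [z] lies in [(s, t)]. Subtracting the
    corresponding boundaries leaves a relation between [s] and [t] alone, which is settled by
    setting [s] to 0. *)
Lemma koszul1 n a x y z : homog_shift n a x -> homog_shift n a y -> homog_shift n a z ->
    'X_ord_s * x + 'X_ord_t * y + 'X_ord_u * z = 0 -> exists al be ga,
  [/\ [/\ homog_shift n a.+1 al, homog_shift n a.+1 be & homog_shift n a.+1 ga],
      x = 'X_ord_t * ga - 'X_ord_u * be, y = 'X_ord_u * al - 'X_ord_s * ga &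
      z = 'X_ord_s * be - 'X_ord_t * al].
Proof.
move=> hx hy hz e.
pose be := shift_down ord_s z; pose al := - shift_down ord_t (kill_var ord_s z).
have hbe : homog_shift n a.+1 be by apply: homog_shift_down.
have hal : homog_shift n a.+1 al.
  by apply: homog_shiftN; apply/homog_shift_down/homog_shift_kill.
have hE : kill_var ord_t (kill_var ord_s z) = 0.
  have := congr1 (fun p => kill_var ord_t (kill_var ord_s p)) e.
  rewrite !kill_varD !kill_var0 kill_varM kill_var0 add0r.
  rewrite (kill_varMX _ (negbT ord_ts)) kill_varM add0r.
  rewrite (kill_varMX _ (negbT ord_us)) (kill_varMX _ (negbT ord_ut)) => /eqP.
  by rewrite mulf_eq0 (negbTE (var_neq0 _)) => /eqP.
have zE : z = 'X_ord_s * be - 'X_ord_t * al.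
  by rewrite {1}(shift_downK ord_s z) {1}(shift_downK ord_t (kill_var ord_s z)) hE /al /be; ring.
have e1 : 'X_ord_s * (x + 'X_ord_u * be) + 'X_ord_t * (y - 'X_ord_u * al) = 0.
  by rewrite -[RHS]e [in RHS]zE; ring.
have hE1 : kill_var ord_s (y - 'X_ord_u * al) = 0.
  have := congr1 (kill_var ord_s) e1; rewrite (kill_varD _ ('X_ord_s * _)) kill_varM kill_var0 add0r.
  rewrite (kill_varMX _ (negbT ord_ts)) => /eqP.
  by rewrite mulf_eq0 (negbTE (var_neq0 _)) => /eqP.
pose ga := - shift_down ord_s (y - 'X_ord_u * al).
have yE : y - 'X_ord_u * al = - ('X_ord_s * ga).
  by rewrite {1}(shift_downK ord_s (y - _)) hE1 /ga; ring.
have xE : x = 'X_ord_t * ga - 'X_ord_u * be.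
  apply: (mulfI (var_neq0 ord_s)); apply/eqP; rewrite -subr_eq0 -e1 yE; apply/eqP; ring.
have yE' : y = 'X_ord_u * al - 'X_ord_s * ga by rewrite -yE; ring.
exists al, be, ga; split=> //; split=> //.
apply/homog_shiftN/homog_shift_down/homog_shiftD => //; apply: homog_shiftN.
have h1 (i : 'I_3) : homog_shift 1 0 ('X_i : T).
  move=> k; rewrite mcoeffX; case: (eqVneq U_(i)%MM k) => [<- _ | _].
    by rewrite mdeg1.
  by rewrite eqxx.
by have := @homog_shiftM n 0 1 a 'X_ord_u al (h1 ord_u); rewrite add0n add1n; apply.
Qed.

(** Setting [t] to 0 in the first equation shows that [t] divides [be]; the two other quotients
    follow by cancelling a variable. *)
Lemma koszul2 n a (al be ga : T) : homog_shift n a al -> homog_shift n a be ->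
    'X_ord_t * ga = 'X_ord_u * be -> 'X_ord_u * al = 'X_ord_s * ga -> 'X_ord_s * be = 'X_ord_t * al ->
  exists s, [/\ homog_shift n a.+1 s, al = 'X_ord_s * s, be = 'X_ord_t * s & ga = 'X_ord_u * s].
Proof.
move=> hal hbe e0 e1 e2.
have hE : kill_var ord_t be = 0.
  have := congr1 (kill_var ord_t) e0; rewrite kill_varM (kill_varMX _ (negbT ord_ut)).
  by move/esym/eqP; rewrite mulf_eq0 (negbTE (var_neq0 _)) => /eqP.
pose s := shift_down ord_t be.
have beE : be = 'X_ord_t * s by rewrite {1}(shift_downK ord_t be) hE addr0.
have gaE : ga = 'X_ord_u * s.
  by apply: (mulfI (var_neq0 ord_t)); rewrite e0 beE; ring.
have alE : al = 'X_ord_s * s.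
  by apply: (mulfI (var_neq0 ord_u)); rewrite e1 gaE; ring.
by exists s; split=> //; apply: homog_shift_down.
Qed.

End Shift.

(** * Koszul exactness for graded column vectors *)

Section Chase.
Variable F : fieldType.
Local Notation T := {mpoly F[3]}.

Definition col_shift m n (a : 'I_m -> nat) (v : 'cV[T]_m) :=
  forall j, homog_shift n (a j) (v j 0).

Definition mx_shift m p (a : 'I_m -> nat) (b : 'I_p -> nat) (A : 'M[T]_(m, p)) :=
  forall i j, homog_shift (b j) (a i) (A i j).

(** The extra shift [c] counts the Koszul steps already made, so one statement serves every stage of
    the chase. *)
Lemma mx_shift_mul m p (a : 'I_m -> nat) (b : 'I_p -> nat) (A : 'M[T]_(m, p)) n c v :
  mx_shift a b A -> col_shift n (fun j => b j + c)%N v ->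
  col_shift n (fun i => a i + c)%N (A *m v).
Proof.
move=> hA hv i; rewrite mxE; apply: homog_shift_sum => j _.
exact: homog_shiftM (hA i j) (hv j).
Qed.

Lemma col_koszul0 m n (a : 'I_m -> nat) v : col_shift n a v ->
    (forall j, (v j 0)@_0%MM = 0) -> exists x y z,
  [/\ col_shift n (fun j => a j + 1)%N x, col_shift n (fun j => a j + 1)%N y,
      col_shift n (fun j => a j + 1)%N z & v = 'X_ord_s *: x + 'X_ord_t *: y + 'X_ord_u *: z].
Proof.
move=> hv v0.
have key j : exists w : T * T * T, [/\ homog_shift n (a j + 1) w.1.1,
    homog_shift n (a j + 1) w.1.2, homog_shift n (a j + 1) w.2 &
    v j 0 = 'X_ord_s * w.1.1 + 'X_ord_t * w.1.2 + 'X_ord_u * w.2].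
  have [x [y [z [hx hy hz e]]]] := koszul0 (hv j) (v0 j).
  by exists (x, y, z); rewrite addn1.
have [w wP] := fin_all_exists key.
exists (\col_j (w j).1.1), (\col_j (w j).1.2), (\col_j (w j).2); split.
- by move=> j; rewrite mxE; case: (wP j).
- by move=> j; rewrite mxE; case: (wP j).
- by move=> j; rewrite mxE; case: (wP j).
by apply/colP => j; rewrite !mxE; case: (wP j).
Qed.

Lemma col_koszul1 m n (a : 'I_m -> nat) x y z c :
    col_shift n (fun j => a j + c)%N x -> col_shift n (fun j => a j + c)%N y ->
    col_shift n (fun j => a j + c)%N z ->
    'X_ord_s *: x + 'X_ord_t *: y + 'X_ord_u *: z = 0 -> exists al be ga,
  [/\ [/\ col_shift n (fun j => a j + c.+1)%N al, col_shift n (fun j => a j + c.+1)%N be &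
          col_shift n (fun j => a j + c.+1)%N ga],
      x = 'X_ord_t *: ga - 'X_ord_u *: be, y = 'X_ord_u *: al - 'X_ord_s *: ga &
      z = 'X_ord_s *: be - 'X_ord_t *: al].
Proof.
move=> hx hy hz e.
have key j : exists w : T * T * T, [/\ [/\ homog_shift n (a j + c.+1) w.1.1,
    homog_shift n (a j + c.+1) w.1.2 & homog_shift n (a j + c.+1) w.2],
    x j 0 = 'X_ord_t * w.2 - 'X_ord_u * w.1.2, y j 0 = 'X_ord_u * w.1.1 - 'X_ord_s * w.2 &
    z j 0 = 'X_ord_s * w.1.2 - 'X_ord_t * w.1.1].
  have ej : 'X_ord_s * x j 0 + 'X_ord_t * y j 0 + 'X_ord_u * z j 0 = 0.
    by move/colP/(_ j): e; rewrite !mxE.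
  have [al [be [ga [[h1 h2 h3] e1 e2 e3]]]] := koszul1 (hx j) (hy j) (hz j) ej.
  by exists (al, be, ga); rewrite addnS.
have [w wP] := fin_all_exists key.
exists (\col_j (w j).1.1), (\col_j (w j).1.2), (\col_j (w j).2); split.
- by split=> j; rewrite mxE; case: (wP j) => [[]].
- by apply/colP => j; rewrite !mxE; case: (wP j).
- by apply/colP => j; rewrite !mxE; case: (wP j).
- by apply/colP => j; rewrite !mxE; case: (wP j).
Qed.

Lemma col_koszul2 m n (a : 'I_m -> nat) al be ga c :
    col_shift n (fun j => a j + c)%N al -> col_shift n (fun j => a j + c)%N be ->
    'X_ord_t *: ga = 'X_ord_u *: be -> 'X_ord_u *: al = 'X_ord_s *: ga -> 'X_ord_s *: be = 'X_ord_t *: al ->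
  exists s : 'cV[T]_m, [/\ col_shift n (fun j => a j + c.+1)%N s,
    al = 'X_ord_s *: s, be = 'X_ord_t *: s & ga = 'X_ord_u *: s].
Proof.
move=> ha hb e0 e1 e2.
have key j : exists s : T, [/\ homog_shift n (a j + c.+1) s,
    al j 0 = 'X_ord_s * s, be j 0 = 'X_ord_t * s & ga j 0 = 'X_ord_u * s].
  have E0 : 'X_ord_t * ga j 0 = 'X_ord_u * be j 0 by move/colP/(_ j): e0; rewrite !mxE.
  have E1 : 'X_ord_u * al j 0 = 'X_ord_s * ga j 0 by move/colP/(_ j): e1; rewrite !mxE.
  have E2 : 'X_ord_s * be j 0 = 'X_ord_t * al j 0 by move/colP/(_ j): e2; rewrite !mxE.
  by have [s [hs s1 s2 s3]] := koszul2 (ha j) (hb j) E0 E1 E2; exists s; rewrite addnS.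
have [w wP] := fin_all_exists key.
exists (\col_j w j); split; first by move=> j; rewrite mxE; case: (wP j).
- by apply/colP => j; rewrite !mxE; case: (wP j).
- by apply/colP => j; rewrite !mxE; case: (wP j).
- by apply/colP => j; rewrite !mxE; case: (wP j).
Qed.

End Chase.

(** * From syzygies to socle elements and back *)

Section Socle.
Variable F : fieldType.
Local Notation T := {mpoly F[3]}.

(** Entries in [(s, t, u)]: minimality when [A] is a differential, and for a vector, triviality
    modulo the maximal ideal. *)
Definition const_free m p (A : 'M[T]_(m, p)) := forall i j, (A i j)@_0%MM = 0.

Lemma const_freeM m p q (A : 'M[T]_(m, p)) (B : 'M_(p, q)) :
  const_free A -> const_free (A *m B).
Proof.
move=> hA i j; rewrite mxE raddf_sum big1 // => l _ /=.
by rewrite rmorphM /= hA mul0r.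
Qed.

Lemma const_freeX m p i (A : 'M[T]_(m, p)) : const_free ('X_i *: A).
Proof. by move=> k l; rewrite mxE mcoeffXM mnm0E. Qed.

Lemma const_freeD m p (A B : 'M[T]_(m, p)) :
  const_free A -> const_free B -> const_free (A + B).
Proof. by move=> hA hB i j; rewrite mxE mcoeffD hA hB addr0. Qed.

Variables (k n0 n1 n2 : nat) (P0 : 'M[T]_(k, n0)) (P1 : 'M[T]_(n0, n1)) (P2 : 'M[T]_(n1, n2)).

(* The connecting correspondence from the minimal generators [c] of the second
   syzygies to the socle elements [s] of [coker P0]: two rounds of Koszul
   exactness along [P2], [P1], [P0]. *)
Definition socle_rel (c : 'cV[T]_n2) (s : 'cV[T]_k) := exists x y z al be ga,
  [/\ P2 *m c = 'X_ord_s *: x + 'X_ord_t *: y + 'X_ord_u *: z,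
      P1 *m x = 'X_ord_t *: ga - 'X_ord_u *: be,
      P1 *m y = 'X_ord_u *: al - 'X_ord_s *: ga,
      P1 *m z = 'X_ord_s *: be - 'X_ord_t *: al &
      [/\ P0 *m al = 'X_ord_s *: s, P0 *m be = 'X_ord_t *: s & P0 *m ga = 'X_ord_u *: s]].

Lemma socle_relD c s c' s' : socle_rel c s -> socle_rel c' s' -> socle_rel (c + c') (s + s').
Proof.
move=> [x [y [z [al [be [ga [e1 e2 e3 e4 [e5 e6 e7]]]]]]]].
move=> [x' [y' [z' [al' [be' [ga' [f1 f2 f3 f4 [f5 f6 f7]]]]]]]].
exists (x + x'), (y + y'), (z + z'), (al + al'), (be + be'), (ga + ga').
split; rewrite ?mulmxDr ?e1 ?e2 ?e3 ?e4 ?f1 ?f2 ?f3 ?f4.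
- by apply/colP => j; rewrite !mxE; ring.
- by apply/colP => j; rewrite !mxE; ring.
- by apply/colP => j; rewrite !mxE; ring.
- by apply/colP => j; rewrite !mxE; ring.
by split; rewrite ?mulmxDr ?e5 ?e6 ?e7 ?f5 ?f6 ?f7 scalerDr.
Qed.

Lemma socle_relZ (a : T) c s : socle_rel c s -> socle_rel (a *: c) (a *: s).
Proof.
move=> [x [y [z [al [be [ga [e1 e2 e3 e4 [e5 e6 e7]]]]]]]].
exists (a *: x), (a *: y), (a *: z), (a *: al), (a *: be), (a *: ga).
split; rewrite -?scalemxAr ?e1 ?e2 ?e3 ?e4.
- by apply/colP => j; rewrite !mxE; ring.
- by apply/colP => j; rewrite !mxE; ring.
- by apply/colP => j; rewrite !mxE; ring.
- by apply/colP => j; rewrite !mxE; ring.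
by split; rewrite -?scalemxAr ?e5 ?e6 ?e7; apply/colP => j; rewrite !mxE; ring.
Qed.

Lemma socle_rel0 : socle_rel 0 0.
Proof.
by exists 0, 0, 0, 0, 0, 0; rewrite !mulmx0 !scaler0 !addr0 subr0.
Qed.

Lemma socle_rel_sum (I : Type) (s : seq I) (c : I -> 'cV[T]_n2) (v : I -> 'cV[T]_k) :
  (forall i, socle_rel (c i) (v i)) -> socle_rel (\sum_(i <- s) c i) (\sum_(i <- s) v i).
Proof.
move=> h; elim: s => [|i s IH]; first by rewrite !big_nil; apply: socle_rel0.
by rewrite !big_cons; apply: socle_relD.
Qed.

(** Minimality puts column [q] of [P2] in [(s, t, u)]. Pushing the resulting triple forward by [P1],
    then by [P0], gives Koszul cycles because consecutive maps compose to 0; each of the three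
    Koszul steps lowers the degree by 1. *)
Lemma socle_rel_exists (a : 'I_k -> nat) (a0 : 'I_n0 -> nat) (a1 : 'I_n1 -> nat)
    (a2 : 'I_n2 -> nat) q :
    mx_shift a a0 P0 -> mx_shift a0 a1 P1 -> mx_shift a1 a2 P2 -> const_free P2 ->
    P0 *m P1 = 0 -> P1 *m P2 = 0 ->
  exists s, socle_rel (delta_mx q 0) s /\ col_shift (a2 q) (fun i => a i + 3)%N s.
Proof.
move=> h0 h1 h2 hc z01 z12; set c := delta_mx q 0.
have P2c j : (P2 *m c) j 0 = P2 j q by rewrite -colE mxE.
have hP : col_shift (a2 q) a1 (P2 *m c) by move=> j; rewrite P2c; apply: h2.
have [|x [y [z [hx hy hz e1]]]] := col_koszul0 hP; first by move=> j; rewrite P2c hc.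
have ex : 'X_ord_s *: (P1 *m x) + 'X_ord_t *: (P1 *m y) + 'X_ord_u *: (P1 *m z) = 0.
  by rewrite !scalemxAr -!mulmxDr -e1 mulmxA z12 mul0mx.
have [al [be [ga [[hal hbe hga] e2 e3 e4]]]] :=
  col_koszul1 (mx_shift_mul h1 hx) (mx_shift_mul h1 hy) (mx_shift_mul h1 hz) ex.
have zz v : P0 *m (P1 *m v) = 0 by rewrite mulmxA z01 mul0mx.
have E0 : 'X_ord_t *: (P0 *m ga) = 'X_ord_u *: (P0 *m be).
  by apply/eqP; rewrite -subr_eq0 !scalemxAr -mulmxBr -e2 zz.
have E1 : 'X_ord_u *: (P0 *m al) = 'X_ord_s *: (P0 *m ga).
  by apply/eqP; rewrite -subr_eq0 !scalemxAr -mulmxBr -e3 zz.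
have E2 : 'X_ord_s *: (P0 *m be) = 'X_ord_t *: (P0 *m al).
  by apply/eqP; rewrite -subr_eq0 !scalemxAr -mulmxBr -e4 zz.
have [s [hs s0 s1 s2]] := col_koszul2 (mx_shift_mul h0 hal) (mx_shift_mul h0 hbe) E0 E1 E2.
exists s; split=> //.
by exists x, y, z, al, be, ga.
Qed.

(** The chase run backwards. If the socle element is [P0 *m w], subtracting the Koszul multiples of
    [w] from [al], [be], [ga] leaves elements of the kernel of [P0], which lift through [P1].
    Repeating along [P1] and [P2] puts [c] in the image of [P3] plus [(s, t, u)] times the free
    module. *)
Lemma socle_rel_inj n3 (P3 : 'M[T]_(n2, n3)) c w :
    (forall v : 'cV_n0, P0 *m v = 0 -> exists u, v = P1 *m u) ->
    (forall v : 'cV_n1, P1 *m v = 0 -> exists u, v = P2 *m u) ->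
    (forall v : 'cV_n2, P2 *m v = 0 -> exists u, v = P3 *m u) ->
    P1 *m P2 = 0 -> const_free P3 ->
  socle_rel c (P0 *m w) -> const_free c.
Proof.
move=> exact01 exact12 exact23 z12 hc [x [y [z [al [be [ga [e1 e2 e3 e4 [e5 e6 e7]]]]]]]].
have [al' al'E] : exists u, al - 'X_ord_s *: w = P1 *m u.
  by apply: exact01; rewrite mulmxBr -scalemxAr e5 subrr.
have [be' be'E] : exists u, be - 'X_ord_t *: w = P1 *m u.
  by apply: exact01; rewrite mulmxBr -scalemxAr e6 subrr.
have [ga' ga'E] : exists u, ga - 'X_ord_u *: w = P1 *m u.
  by apply: exact01; rewrite mulmxBr -scalemxAr e7 subrr.
have [x' x'E] : exists u, x - ('X_ord_t *: ga' - 'X_ord_u *: be') = P2 *m u.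
  apply: exact12; rewrite !mulmxBr -!scalemxAr -ga'E -be'E e2.
  by apply/colP => j; rewrite !mxE; ring.
have [y' y'E] : exists u, y - ('X_ord_u *: al' - 'X_ord_s *: ga') = P2 *m u.
  apply: exact12; rewrite !mulmxBr -!scalemxAr -ga'E -al'E e3.
  by apply/colP => j; rewrite !mxE; ring.
have [z' z'E] : exists u, z - ('X_ord_s *: be' - 'X_ord_t *: al') = P2 *m u.
  apply: exact12; rewrite !mulmxBr -!scalemxAr -al'E -be'E e4.
  by apply/colP => j; rewrite !mxE; ring.
have [v vE] : exists u, c - ('X_ord_s *: x' + 'X_ord_t *: y' + 'X_ord_u *: z') = P3 *m u.
  apply: exact23; rewrite mulmxBr !mulmxDr -!scalemxAr -x'E -y'E -z'E e1.
  by apply/colP => j; rewrite !mxE; ring.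
rewrite -[c](subrK ('X_ord_s *: x' + 'X_ord_t *: y' + 'X_ord_u *: z')) vE.
apply: const_freeD; first exact: const_freeM.
by do 2?[apply: const_freeD]; apply: const_freeX.
Qed.

(** The same backward chase, one stage shorter: it starts from a triple [(x, y, z)] that equals
    [(s, t, u) * w] modulo the image of [Q1]. *)
Lemma syzygy_const_free (Q1 : 'M[T]_(k, n0)) (Q2 : 'M[T]_(n0, n1)) (Q3 : 'M[T]_(n1, n2)) c
    (al be ga : 'cV[T]_n0) (x y z w : 'cV[T]_k) (u0 u1 u2 : 'cV[T]_n0) :
    (forall v : 'cV_n0, Q1 *m v = 0 -> exists u, v = Q2 *m u) ->
    (forall v : 'cV_n1, Q2 *m v = 0 -> exists u, v = Q3 *m u) -> const_free Q3 ->
    Q2 *m c = 'X_ord_s *: al + 'X_ord_t *: be + 'X_ord_u *: ga ->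
    Q1 *m al = 'X_ord_t *: z - 'X_ord_u *: y -> Q1 *m be = 'X_ord_u *: x - 'X_ord_s *: z ->
    Q1 *m ga = 'X_ord_s *: y - 'X_ord_t *: x ->
    x - 'X_ord_s *: w = Q1 *m u0 -> y - 'X_ord_t *: w = Q1 *m u1 -> z - 'X_ord_u *: w = Q1 *m u2 ->
  const_free c.
Proof.
move=> exact12 exact23 hc e e0 e1 e2 f0 f1 f2.
have [al' al'E] : exists u, al - ('X_ord_t *: u2 - 'X_ord_u *: u1) = Q2 *m u.
  apply: exact12; rewrite !mulmxBr -!scalemxAr -f1 -f2 e0.
  by apply/colP => j; rewrite !mxE; ring.
have [be' be'E] : exists u, be - ('X_ord_u *: u0 - 'X_ord_s *: u2) = Q2 *m u.
  apply: exact12; rewrite !mulmxBr -!scalemxAr -f0 -f2 e1.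
  by apply/colP => j; rewrite !mxE; ring.
have [ga' ga'E] : exists u, ga - ('X_ord_s *: u1 - 'X_ord_t *: u0) = Q2 *m u.
  apply: exact12; rewrite !mulmxBr -!scalemxAr -f0 -f1 e2.
  by apply/colP => j; rewrite !mxE; ring.
have [v vE] : exists u, c - ('X_ord_s *: al' + 'X_ord_t *: be' + 'X_ord_u *: ga') = Q3 *m u.
  apply: exact23; rewrite mulmxBr !mulmxDr -!scalemxAr -al'E -be'E -ga'E e.
  by apply/colP => j; rewrite !mxE; ring.
rewrite -[c](subrK ('X_ord_s *: al' + 'X_ord_t *: be' + 'X_ord_u *: ga')) vE.
apply: const_freeD; first exact: const_freeM.
by do 2?[apply: const_freeD]; apply: const_freeX.
Qed.

Lemma delta_not_const_free n (q : 'I_n) : ~ const_free (delta_mx q 0 : 'cV[T]_n).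
Proof. by move/(_ q 0)/eqP; rewrite mxE !eqxx mcoeff1 eqxx oner_eq0. Qed.

End Socle.

(** * Counting dimensions *)

Lemma indep_card_le (F : fieldType) (V : lmodType F) (I H : finType) (u : I -> V) (v : H -> V) :
    (forall c : I -> F, \sum_i c i *: u i = 0 -> forall i, c i = 0) ->
    (forall i, exists c : H -> F, u i = \sum_j c j *: v j) ->
  (#|I| <= #|H|)%N.
Proof.
move=> ind span; have [c cE] := fin_all_exists span.
pose C : 'M[F]_(#|I|, #|H|) := \matrix_(i, j) c (enum_val i) (enum_val j).
rewrite leqNgt; apply/negP => lt.
have : kermx C != 0.
  by rewrite -mxrank_eq0 mxrank_ker subn_eq0 -ltnNge (leq_ltn_trans (rank_leq_col _)).
case/rowV0Pn => r /sub_kermxP rC /negP; apply; apply/eqP/rowP => k; rewrite mxE.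
rewrite -(enum_valK k); apply: (ind (fun i => r 0 (enum_rank i))).
under eq_bigr => i _ do rewrite cE scaler_sumr.
rewrite exchange_big big1 //= => j _.
under eq_bigr => i _ do rewrite scalerA.
rewrite -scaler_suml (_ : \sum_i _ = (r *m C) 0 (enum_rank j)); last first.
  rewrite mxE (reindex_onto (@enum_val _ predT) enum_rank) /=; last by move=> i _; rewrite enum_rankK.
  apply: eq_big => [l | l _]; first by rewrite enum_valK eqxx.
  by rewrite mxE enum_rankK enum_valK.
by rewrite rC mxE scale0r.
Qed.

Lemma homog_span (F : fieldType) k : exists v : 'I_('C(k + 2, k)) -> {mpoly F[3]},
  forall p, p \is k.-homog -> exists c : 'I_('C(k + 2, k)) -> F, p = \sum_j c j *: v j.
Proof.
have [h lh [h' hK h'K]] := dhomog_vecaxiom 2 F k.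
have lh' : linear h'.
  by move=> c x y; apply: (can_inj hK); rewrite lh !h'K.
exists (fun j => val (h' (delta_mx 0 j))) => p hp.
exists (fun j => h (DHomog hp) 0 j).
rewrite -[p]/(val (DHomog hp)) -{1}[DHomog hp]hK.
rewrite {1}[h (DHomog hp)]row_sum_delta.
have h'0 : h' 0 = 0 by have := lh' (-1) 0 0; rewrite !scaler0 addr0 scaleN1r addNr.
elim/big_rec2: _ => [|j x y _ IH]; first by rewrite h'0.
by rewrite lh' /= IH.
Qed.

(** * Ranks over the fraction field *)

Section Fraction.
Variable R : idomainType.
Local Notation tf := (@FracField.tofrac R).

Lemma clear_denominators n (v : 'cV[{fraction R}]_n) : exists (c : R) (w : 'cV[R]_n),
  c != 0 /\ tf c *: v = map_mx tf w.
Proof.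
pose dn j := (frac (repr (v j 0))).2.
exists (\prod_j dn j), (\col_j ((frac (repr (v j 0))).1 * \prod_(l | l != j) dn l)).
split; first by apply/prodf_neq0 => j _; apply: denom_ratioP.
apply/colP => j; rewrite !mxE (bigD1 j) //= !tofracM -fraction_reprM.
by rewrite mulrC mulrA.
Qed.

(* Exactness at the middle of [R^p -> R^n -> R^m] survives localisation. *)
Lemma exact_rank_ge m n p (A : 'M[R]_(m, n)) (B : 'M[R]_(n, p)) :
    (forall v : 'cV[R]_n, A *m v = 0 -> exists w, v = B *m w) ->
  (n <= \rank (map_mx tf A) + p)%N.
Proof.
move=> ex; set AK := map_mx tf A; set BK := map_mx tf B.
have : (kermx AK^T <= BK^T)%MS.
  apply/row_subP => i; set v := row i _.
  have vA : v *m AK^T = 0 by apply/sub_kermxP; apply: row_sub.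
  (* A kernel vector over the fraction field becomes one over [R] after clearing denominators, and
     exactness over [R] applies to it. *)
  have [c [w [c0 cw]]] := clear_denominators v^T.
  have [u wE] : exists u, w = B *m u.
    apply: ex; apply/matrixP => k l; rewrite [RHS]mxE; apply/eqP.
    rewrite -(tofrac_eq0 ((A *m w) k l)).
    have -> : tf ((A *m w) k l) = (map_mx tf (A *m w)) k l by rewrite [RHS]mxE.
    rewrite map_mxM -cw -scalemxAr.
    by have := congr1 trmx vA; rewrite trmx_mul trmxK trmx0 => ->; rewrite scaler0 mxE eqxx.
  apply/submxP; exists ((tf c)^-1 *: (map_mx tf u)^T).
  rewrite -scalemxAl -trmx_mul -map_mxM -wE -cw linearZ /= trmxK scalerA mulVf ?scale1r //.
  by rewrite tofrac_eq0.
move/mxrankS; rewrite mxrank_ker !mxrank_tr => h.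
have := rank_leq_col BK; lia.
Qed.

End Fraction.

(** * The minimal resolution *)

Lemma scale_var_eq0 (F : fieldType) p q i (A : 'M[{mpoly F[3]}]_(p, q)) :
  'X_i *: A = 0 -> A = 0.
Proof.
move=> /matrixP e; apply/matrixP => k l; have /eqP := e k l.
by rewrite !mxE mulf_eq0 (negbTE (var_neq0 _ _)) => /eqP.
Qed.

Lemma mulmx_eq0 (R : comRingType) p q r (A : 'M[R]_(p, q)) (B : 'M_(q, r)) :
  (forall w : 'cV_r, A *m (B *m w) = 0) -> A *m B = 0.
Proof.
move=> h; apply/matrixP => i j.
have /matrixP/(_ i 0) := h (delta_mx j 0 : 'cV_r).
by rewrite mulmxA -colE !mxE.
Qed.

Section HilbertFunction.
Variables (F : fieldType) (m : nat) (f : 'I_m -> {mpoly F[3]}).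
Local Notation T := {mpoly F[3]}.
Local Notation J := (ideal_gen f).

(** Multiplication by a power of [s] is injective and preserves [J]. *)
Lemma hilb_mono k l h h' : (k <= l)%N -> hilb J k h -> hilb J l h' -> (h <= h')%N.
Proof.
move=> kl [v [vJ vind _]] [w [_ _ wspan]].
have := @indep_card_le F T 'I_h 'I_h' (fun i => 'X_ord_s ^+ (l - k) * v i) w.
rewrite !card_ord; apply.
  move=> c c0; apply: vind.
  have X0 : 'X_ord_s ^+ (l - k) != 0 :> T by rewrite expf_neq0 // var_neq0.
  apply: (mulfI X0); rewrite mulr0 -[RHS]c0 mulr_sumr; apply: eq_bigr => i _.
  by rewrite -scalerAr.
move=> i; have [Ji hi] := vJ i; apply: wspan; first exact: ideal_genM.
by have := dhomogM (homog_varX F ord_s (l - k)) hi; rewrite subnK.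
Qed.

Lemma hilb_le k h : hilb J k h -> (h <= 'C(k + 2, k))%N.
Proof.
move=> [v [vJ vind _]]; have [w wspan] := @homog_span F k.
have := indep_card_le vind (v := w); rewrite !card_ord; apply=> i.
by have [_ hi] := vJ i; apply: wspan.
Qed.

End HilbertFunction.

Section Resolution.
Variables (F : fieldType) (m : nat) (f : 'I_m -> {mpoly F[3]}).
Local Notation T := {mpoly F[3]}.
Local Notation J := (ideal_gen f).
Variables (b : nat -> nat) (a : nat -> nat -> nat) (g : 'rV[T]_(b 0%N))
  (M : forall i, 'M[T]_(b i, b i.+1)) (L : nat).
Hypothesis res : min_graded_res J b a g M L.

Lemma betti_above i : (L < i)%N -> b i = 0%N. Proof. by case: res => h _ _ _ _; apply: h. Qed.

Lemma mem_idealP p : J p <-> exists v : 'cV[T]_(b 0%N), p = (g *m v) 0 0.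
Proof. by case: res => _ _ _ h _; apply: h. Qed.

Lemma exact_gens (v : 'cV_(b 0%N)) : g *m v = 0 -> exists w, v = M 0%N *m w.
Proof. by case: res => _ _ _ _ [h _]; apply h. Qed.

Lemma exact_diff i (v : 'cV_(b i.+1)) : M i *m v = 0 -> exists w, v = M i.+1 *m w.
Proof. by case: res => _ _ _ _ [_ h]; apply h. Qed.

Lemma gens_diff : g *m M 0%N = 0.
Proof.
by apply: mulmx_eq0 => w; case: res => _ _ _ _ [h _]; apply/h; exists w.
Qed.

Lemma diff_diff i : M i *m M i.+1 = 0.
Proof.
by apply: mulmx_eq0 => w; case: res => _ _ _ _ [_ h]; apply/h; exists w.
Qed.

Lemma diff_shift i : mx_shift (fun j : 'I_(b i) => a i j) (fun j : 'I_(b i.+1) => a i.+1 j) (M i).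
Proof.
move=> p q k; case: res => _ _ /(_ i p q) [-> | [lt hM]] _ _; first by rewrite mcoeff0 eqxx.
by rewrite -mcoeff_msupp => /(dhomog_mf hM) /= ->; rewrite subnK // ltnW.
Qed.

Lemma diff_free i : const_free (M i).
Proof.
move=> p q; case: res => _ _ /(_ i p q) [-> | [lt hM]] _ _; first by rewrite mcoeff0.
apply: (dhomog_nemf_coeff hM); rewrite /= mdeg0; apply/eqP; lia.
Qed.

Lemma gens_homog (j : 'I_(b 0%N)) : g 0 j \is (a 0%N j).-homog.
Proof. by case: res => _ h _ _ _; apply: h. Qed.

Lemma gens_shift : mx_shift (fun=> 0%N) (fun j : 'I_(b 0%N) => a 0%N j) g.
Proof.
move=> i j k; rewrite ord1 -mcoeff_msupp => /(dhomog_mf (gens_homog j)) /= ->.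
by rewrite addn0.
Qed.

Lemma gens_lift : exists V : 'I_m -> 'cV[T]_(b 0%N), forall i, f i = (g *m V i) 0 0.
Proof.
have h i : exists v : 'cV[T]_(b 0%N), f i = (g *m v) 0 0.
  by apply/mem_idealP; apply: ideal_gen_mem.
exact: fin_all_exists h.
Qed.

Lemma gens_mem j : J (g 0 j).
Proof. by apply/mem_idealP; exists (delta_mx j 0); rewrite -colE mxE. Qed.

(** The difference is a relation among the [g 0 j], so it comes from [M 0], whose entries lie in
    [(s, t, u)]. Thus, modulo [(s, t, u)], basis vectors are combinations of lifts of the [f i]. *)
Lemma generator_relation (V : 'I_m -> 'cV[T]_(b 0%N)) (c : 'I_m -> T) j :
    (forall i, f i = (g *m V i) 0 0) -> g 0 j = \sum_i c i * f i ->
  const_free (delta_mx j 0 - \sum_i c i *: V i).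
Proof.
move=> fV gE; have [w ->] : exists w, delta_mx j 0 - \sum_i c i *: V i = M 0%N *m w.
  apply: exact_gens; apply/matrixP => k l; rewrite mulmxBr !ord1 -colE mulmx_sumr !mxE.
  rewrite summxE gE; apply/eqP; rewrite subr_eq0; apply/eqP; apply: eq_bigr => i _.
  by rewrite -scalemxAr [RHS]mxE fV.
exact/const_freeM/diff_free.
Qed.

(** Taking constant terms in [generator_relation] factors the identity of size [b 0] through
    [F^m]. *)
Lemma betti0_le : (b 0%N <= m)%N.
Proof.
have [V fV] := gens_lift.
have key j : exists c : 'I_m -> T, g 0 j = \sum_i c i * f i by apply: gens_mem.
have [c cE] := fin_all_exists key.
pose A : 'M[F]_(b 0%N, m) := \matrix_(l, i) (V i l 0)@_0%MM.
pose C : 'M[F]_(m, b 0%N) := \matrix_(i, j) (c j i)@_0%MM.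
have AC : A *m C = 1%:M.
  apply/matrixP => l j; have := generator_relation fV (cE j) l 0.
  rewrite mxE [X in _ + X]mxE [delta_mx _ _ _ _]mxE eqxx andbT mcoeffB => /eqP.
  rewrite subr_eq0 summxE raddf_sum => /eqP e1.
  have {e1} : (l == j)%:R = \sum_i ((c j i *: V i) l 0)@_0%MM.
    by rewrite -e1; case: (l == j); rewrite ?mcoeff1 ?eqxx ?mcoeff0.
  rewrite !mxE => ->; apply: eq_bigr => i _; rewrite !mxE /= rmorphM mulrC.
  reflexivity.
have := mxrankM_maxl A C; rewrite AC mxrank1 => h.
exact: leq_trans h (rank_leq_col A).
Qed.

(** A third syzygy yields [s] with [X_i * s] in the image of [M 0]. As [g] takes values in a domain,
    [s] lies in the kernel of [g], hence in the image of [M 0], and [socle_rel_inj] contradicts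
    minimality. Once some [b i] is 0, every vector at the next place is a boundary, so minimality
    empties it too. *)
Lemma betti_vanish i : (3 <= i)%N -> b i = 0%N.
Proof.
have none n : ('I_n -> False) -> n = 0%N by case: n => // n; case; exact: ord0.
elim: i => // i IH; rewrite ltnS leq_eqVlt => /orP [/eqP <- | /IH bi]; apply: none => q.
  have [s [rs _]] := socle_rel_exists q (@diff_shift 0) (@diff_shift 1) (@diff_shift 2)
    (@diff_free 2) (diff_diff 0) (diff_diff 1).
  have [x [y [z [al [be [ga [_ _ _ _ [e5 _ _]]]]]]]] := rs.
  have gs : g *m s = 0.
    have : 'X_ord_s *: (g *m s) = 0 by rewrite scalemxAr -e5 mulmxA gens_diff mul0mx.
    exact: scale_var_eq0.
  have [w sE] := exact_gens gs; rewrite sE in rs.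
  exact: (delta_not_const_free (socle_rel_inj (@exact_diff 0) (@exact_diff 1) (@exact_diff 2) (diff_diff 1) (@diff_free 3) rs)).
have [|w wE] := @exact_diff i (delta_mx q 0); first by apply/colP => j; have := ltn_ord j; rewrite {2}bi.
by apply: (@delta_not_const_free F _ q); rewrite wE; apply/const_freeM/diff_free.
Qed.

Lemma socle_elements : exists s : 'I_(b 2%N) -> T,
  [/\ forall q, s q \is (a 2%N q - 3).-homog /\ (3 <= a 2%N q)%N,
      forall q i, J ('X_i * s q) &
      forall c : 'I_(b 2%N) -> T, J (\sum_q c q * s q) -> forall q, (c q)@_0%MM = 0].
Proof.
have key (q : 'I_(b 2%N)) : exists s, socle_rel g (M 0%N) (M 1%N) (delta_mx q 0) s /\
    col_shift (a 2%N q) (fun i => 0 + 3)%N s.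
  exact: socle_rel_exists q gens_shift (@diff_shift 0) (@diff_shift 1) (@diff_free 1) gens_diff (diff_diff 0).
have [s sP] := fin_all_exists key.
have ind (c : 'I_(b 2%N) -> T) : J (\sum_q c q * s q 0 0) -> forall q, (c q)@_0%MM = 0.
  move/mem_idealP => [w wE].
  have rs : socle_rel g (M 0%N) (M 1%N) (\sum_q c q *: delta_mx q 0) (g *m w).
    have -> : g *m w = \sum_q c q *: s q.
      apply/matrixP => k l; rewrite !ord1 -wE summxE; apply: eq_bigr => q _.
      by rewrite mxE.
    by apply: socle_rel_sum => q; apply: socle_relZ; case: (sP q).
  move=> q; have := socle_rel_inj exact_gens (@exact_diff 0) (@exact_diff 1) (diff_diff 0) (@diff_free 2) rs q 0.
  rewrite summxE (bigD1 q) //= big1 ?addr0; first by rewrite !mxE !eqxx mulr1.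
  by move=> l lq; rewrite !mxE eq_sym (negbTE lq) mulr0.
have Jk k l (v : 'cV[T]_(b 0%N)) : g *m v = 'X_k *: s l -> J ('X_k * s l 0 0).
  by move=> e0; apply/mem_idealP; exists v; rewrite e0 mxE.
exists (fun q => s q 0 0); split=> //.
  move=> q; have [_ hs] := sP q; split; first exact: homog_shiftP (hs 0).
  (* Independence modulo [J] makes the element nonzero, so its degree is exactly [a 2 q - 3],
     without truncation. *)
  have : s q 0 0 != 0.
    apply/eqP => s0; have Js : J (\sum_l (l == q)%:R * s l 0 0).
      rewrite (bigD1 q) //= s0 mulr0 big1 ?addr0; first exact: ideal_gen0.
      by move=> l /negbTE ->; rewrite mul0r.
    by have /eqP := ind (fun l => (l == q)%:R) Js q; rewrite eqxx mcoeff1 eqxx oner_eq0.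
  by rewrite -mleadc_eq0 => /(hs 0); lia.
move=> q; have [[x [y [z [al [be [ga [_ _ _ _ [e5 e6 e7]]]]]]]] _] := sP q.
by apply: ord3P; [apply: Jk e5 | apply: Jk e6 | apply: Jk e7].
Qed.

Lemma socle_family R : (forall q : 'I_(b 2%N), (a 2%N q - 2 <= R)%N) ->
  exists t : 'I_(b 2%N) -> T, (forall q, J (t q) /\ t q \is R.-homog) /\
    forall c : 'I_(b 2%N) -> F, \sum_q c q *: t q = 0 -> forall q, c q = 0.
Proof.
move=> hR; have [s [hs Js ind]] := socle_elements.
(* The exponent is at least 1 because [a 2 q - 2 <= R]; one factor [s] already moves the socle
   element into [J]. *)
exists (fun q : 'I_(b 2%N) => 'X_ord_s ^+ (R - (a 2%N q - 3)) * s q); split.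
  move=> q; have [hq a3] := hs q; have Rq := hR q.
  have er : (R - (a 2%N q - 3) = (R - (a 2%N q - 2)).+1)%N by lia.
  split; first by rewrite er exprSr -mulrA; apply: ideal_genM.
  have := dhomogM (homog_varX F ord_s (R - (a 2%N q - 3))) hq.
  by rewrite subnK //; lia.
move=> c c0 q0.
have [//|cq0] := eqVneq (c q0) 0.
(* Among the indices with nonzero coefficient, take one of largest degree and cancel its power of
   [s]. Its cofactor is then the constant [c q1], which independence modulo [J] forces to be 0. *)
case: (@arg_maxnP _ q0 (fun q => c q != 0) (fun q : 'I_(b 2%N) => a 2%N q) cq0) => q1 cq1 max1.
pose E (q : 'I_(b 2%N)) := ((a 2%N q1 - 3) - (a 2%N q - 3))%N.
have e0 : \sum_q (c q *: 'X_ord_s ^+ E q) * s q = 0.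
  have X0 : 'X_ord_s ^+ (R - (a 2%N q1 - 3)) != 0 :> T by rewrite expf_neq0 // var_neq0.
  apply: (mulfI X0); rewrite mulr0 -[RHS]c0 mulr_sumr; apply: eq_bigr => q _.
  have [-> | cq] := eqVneq (c q) 0; first by rewrite !scale0r mul0r mulr0.
  rewrite -!scalerAl -scalerAr mulrA -exprD; congr (_ *: ('X_ord_s ^+ _ * _)).
  by have := max1 _ cq; have := hR q1; have := hR q; rewrite /E; lia.
have := ind (fun q => c q *: 'X_ord_s ^+ E q) _ q1.
rewrite e0 mcoeffZ /E subnn expr0 mcoeff1 eqxx mulr1 => h.
by case/eqP: cq1; apply: h; apply: ideal_gen0.
Qed.

Lemma reg_ge (q : 'I_(b 2%N)) : (a 2%N q - 2 <= reg_of b a L)%N.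
Proof.
have L2 : (2 < L.+1)%N.
  by rewrite ltnNge; apply/negP => h; have := ltn_ord q; rewrite {2}betti_above.
have := @leq_bigmax _ (fun i : 'I_L.+1 => \max_(j < b i) (a i j - i))%N (Ordinal L2).
apply: leq_trans.
exact: (@leq_bigmax _ (fun j : 'I_(b 2%N) => a 2%N j - 2)%N q).
Qed.

Lemma betti2_le_hilb h : hilb J (reg_of b a L) h -> (b 2%N <= h)%N.
Proof.
move=> [v [_ _ vspan]]; have [t [tJ tind]] := socle_family reg_ge.
have := indep_card_le tind (v := v); rewrite !card_ord; apply=> q.
by have [Jq hq] := tJ q; apply: vspan.
Qed.

Hypothesis cop : gcd_one f.

(** With [r] the rank of [M 0], exactness gives [b 1 <= r + b 2]; since [g] is nonzero and kills
    [M 0], [r + 1 <= b 0]; and [b 0 <= m]. *)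
Lemma betti1_le : (b 1%N <= b 2%N + m - 1)%N.
Proof.
have h1 := exact_rank_ge (@exact_diff 0); set r := \rank _ in h1.
have gN0 : map_mx (@FracField.tofrac T) g != 0.
  have [i fi] := gcd_one_neq0 cop; apply: contraNneq fi => g0.
  have /mem_idealP [v ->] := ideal_gen_mem f i.
  have -> : g = 0.
    apply/matrixP => k l; rewrite [RHS]mxE; apply/eqP; rewrite -tofrac_eq0.
    by move/matrixP/(_ k l)/eqP: g0; rewrite !mxE.
  by rewrite mul0mx mxE.
have h2 : (\rank (map_mx (@FracField.tofrac T) g) + r <= b 0%N)%N.
  by apply: mulmx0_rank_max; rewrite -map_mxM gens_diff map_mx0.
have h3 : (0 < \rank (map_mx (@FracField.tofrac T) g))%N by rewrite lt0n mxrank_eq0.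
have := betti0_le; lia.
Qed.

Variables (d : nat) (e : 'I_m -> nat).
Hypotheses (fh : forall i, f i \is (e i).-homog) (ed : forall i, (e i <= d)%N).
Hypothesis d_gt0 : (0 < d)%N.

(** A generator of degree above [d] would be a combination of the [f i] with all coefficients of
    positive degree, making its basis vector trivial modulo [(s, t, u)]. *)
Lemma generator_degree (j : 'I_(b 0%N)) : (a 0%N j <= d)%N.
Proof.
rewrite leqNgt; apply/negP => lt; have [V fV] := gens_lift.
have [c [gE hc _]] := ideal_gen_coefs fh (gens_mem j) (gens_homog j).
apply: (@delta_not_const_free F _ j).
rewrite -[delta_mx j 0](subrK (\sum_i c i *: V i)).
apply: const_freeD; first exact: generator_relation.
move=> k l; rewrite summxE raddf_sum big1 // => i _.
rewrite /= mxE rmorphM /=; have ei := ed i.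
have hci : c i \is (a 0%N j - e i).-homog by apply: hc; lia.
rewrite (dhomog_nemf_coeff hci) ?mul0r //= mdeg0; apply/eqP; lia.
Qed.

Lemma syzygy_degree (q : 'I_(b 1%N)) : (a 1%N q < 3 * d)%N.
Proof.
rewrite ltnNge; apply/negP => le; set c := delta_mx q 0 : 'cV[T]_(b 1%N).
have Mc j : (M 0%N *m c) j 0 = M 0%N j q by rewrite -colE mxE.
have hP : col_shift (a 1%N q) (fun j : 'I_(b 0%N) => a 0%N j) (M 0%N *m c).
  by move=> j; rewrite Mc; apply: diff_shift.
have [|al [be [ga [hal hbe hga e0]]]] := col_koszul0 hP; first by move=> j; rewrite Mc diff_free.
have ex : 'X_ord_s *: (g *m al) + 'X_ord_t *: (g *m be) + 'X_ord_u *: (g *m ga) = 0.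
  by rewrite !scalemxAr -!mulmxDr -e0 mulmxA gens_diff mul0mx.
have [x [y [z [[hx hy hz] e1 e2 e3]]]] :=
  col_koszul1 (mx_shift_mul gens_shift hal) (mx_shift_mul gens_shift hbe) (mx_shift_mul gens_shift hga) ex.
have hdeg (v : 'cV[T]_1) : col_shift (a 1%N q) (fun=> 2) v -> v 0 0 \is (a 1%N q - 2).-homog.
  by move=> hv; apply: homog_shiftP (hv 0).
have ent (v w1 w2 : 'cV[T]_1) i j : v = 'X_i *: w1 - 'X_j *: w2 ->
    v 0 0 = 'X_i * w1 0 0 - 'X_j * w2 0 0 by move=> ->; rewrite !mxE.
have Jg (v : 'cV[T]_(b 0%N)) : J ((g *m v) 0 0) by apply/mem_idealP; exists v.
have J01 : J ('X_ord_s * y 0 0 - 'X_ord_t * x 0 0) by rewrite -(ent _ _ _ _ _ e3).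
have J02 : J ('X_ord_s * z 0 0 - 'X_ord_u * x 0 0).
  by rewrite -opprB -(ent _ _ _ _ _ e2); apply: ideal_genN.
have J12 : J ('X_ord_t * z 0 0 - 'X_ord_u * y 0 0) by rewrite -(ent _ _ _ _ _ e1).
(* Two Koszul steps lower the degree by 2, so a first syzygy of degree at least [3 * d] reaches the
   range of [koszul_bound]. *)
have hk : (3 * d - 2 <= a 1%N q - 2)%N by lia.
have [w [Jx Jy Jz]] := koszul_bound fh ed d_gt0 cop (hdeg _ hx) (hdeg _ hy) (hdeg _ hz) hk
  J01 J02 J12.
have lift i (v : 'cV[T]_1) : J (v 0 0 - 'X_i * w) ->
    exists u : 'cV[T]_(b 0%N), v - 'X_i *: const_mx w = g *m u.
  move/mem_idealP => [u uE]; exists u; apply/matrixP => k l.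
  by rewrite !ord1 -uE !mxE.
have [u0 u0E] := lift _ _ Jx; have [u1 u1E] := lift _ _ Jy; have [u2 u2E] := lift _ _ Jz.
exact: (delta_not_const_free (syzygy_const_free exact_gens (@exact_diff 0) (@diff_free 1) e0 e1 e2 e3
  u0E u1E u2E)).
Qed.

Lemma socle_degree (q : 'I_(b 2%N)) : (a 2%N q <= 3 * d)%N.
Proof.
have [s [hs Js ind]] := socle_elements; have [hq a3] := hs q.
rewrite leqNgt; apply/negP => lt.
(* Degree [a 2 q > 3 * d] puts the socle element in degree at least [3 * d - 2], where it must lie
   in [J]. *)
have Jq : J (s q) by apply: (socle_bound fh ed d_gt0 cop hq) => //; lia.
have Jsum : J (\sum_l (l == q)%:R * s l).
  rewrite (bigD1 q) //= eqxx mul1r big1 ?addr0 //.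
  by move=> l /negbTE ->; rewrite mul0r.
by have /eqP := ind (fun l => (l == q)%:R) Jsum q; rewrite eqxx mcoeff1 eqxx oner_eq0.
Qed.

Lemma reg_le : (reg_of b a L <= 3 * d - 2)%N.
Proof.
apply/bigmax_leqP => i _; apply/bigmax_leqP => j _.
case: i j => [[|[|[|i]]] hi] /= j.
- by have := generator_degree j; lia.
- by have := syzygy_degree j; lia.
- by have := socle_degree j; lia.
by have := ltn_ord j; rewrite {2}betti_vanish.
Qed.

(** Place the socle family in degree [3 * d - 2] instead of the regularity: there [J] is spanned by
    the products of the [m] generators with forms of degree [2 * d - 2], a space of dimension
    ['C(2 * d, 2)]. *)
Lemma betti2_le_equigenerated : (forall i, f i \is d.-homog) ->
  (b 2%N <= m * 'C(2 * d, 2))%N.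
Proof.
move=> fd; have hR (q : 'I_(b 2%N)) : (a 2%N q - 2 <= 3 * d - 2)%N by apply: leq_trans (reg_ge q) reg_le.
have -> : ('C(2 * d, 2) = 'C(2 * d - 2 + 2, 2 * d - 2))%N by rewrite subnK ?bin_sub //; lia.
have [t [tJ tind]] := socle_family hR; have [w wspan] := @homog_span F (2 * d - 2).
have := @indep_card_le F T _ ('I_m * 'I_('C(2 * d - 2 + 2, 2 * d - 2)))%type t
  (fun ij => w ij.2 * f ij.1) tind.
rewrite card_prod !card_ord.
apply=> q; have [Jq hq] := tJ q.
have [c [tE hc _]] := ideal_gen_coefs fd Jq hq.
have key i : exists ga : 'I_('C(2 * d - 2 + 2, 2 * d - 2)) -> F, c i = \sum_j ga j *: w j.
  apply: wspan; have -> : (2 * d - 2 = 3 * d - 2 - d)%N by lia.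
  by apply: hc; lia.
have [ga gaE] := fin_all_exists key; exists (fun ij => ga ij.1 ij.2).
rewrite tE; rewrite -(pair_bigA _ (fun i j => ga i j *: (w j * f i))) /=.
apply: eq_bigr => i _; rewrite gaE mulr_suml; apply: eq_bigr => j _.
by rewrite -scalerAl.
Qed.

End Resolution.

Theorem theorem3p3 (F : fieldType) (m d : nat) (f : 'I_m -> {mpoly F[3]}) :
  (2 <= m)%N -> (0 < d)%N ->
  (forall i, exists e, (e <= d)%N /\ is_homog e (f i)) ->
  gcd_one f ->
  forall (b : nat -> nat) (a : nat -> nat -> nat) (g : 'rV[{mpoly F[3]}]_(b 0%N))
         (M : forall i, 'M[{mpoly F[3]}]_(b i, b i.+1)) (L : nat),
  min_graded_res (ideal_gen f) b a g M L ->
  [/\ (reg_of b a L <= 3 * d - 2)%N,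
      (b 1%N <= b 2%N + m - 1)%N,
      (forall h1 h2 : nat,
         hilb (ideal_gen f) (reg_of b a L) h1 ->
         hilb (ideal_gen f) (3 * d - 2) h2 ->
         [/\ (b 2%N <= h1)%N, (h1 <= h2)%N & (h2 <= 'C(3 * d, 2))%N]) &
      ((forall i, is_homog d (f i) /\ f i != 0) -> (b 2%N <= m * 'C(2 * d, 2))%N)].
Proof.
move=> _ d0 /fin_all_exists [e he] cop b a g M L res.
have ed i : (e i <= d)%N by case: (he i).
have fh i : f i \is (e i).-homog by case: (he i).
have rle := reg_le res cop fh ed d0.
split=> //; first exact: betti1_le res cop.
  move=> h1 h2 H1 H2; split; first exact: betti2_le_hilb res _ H1.
    exact: hilb_mono rle H1 H2.
  by apply: leq_trans (hilb_le H2) _; rewrite subnK ?bin_sub //; lia.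
by move=> fd; apply: (betti2_le_equigenerated res cop fh ed d0) => i; case: (fd i).
Qed.
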